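(* Let $K$ be a number field, let $\mathfrak{m}$ be a finite modulus of $K$, and let $Cl_K^{\mathfrak{m}}$ be the ray class group of $K$ modulo $\mathfrak{m}$. If a subset $\mathcal{C}=\{C_1,\dots,C_r\}\subset Cl_K^{\mathfrak{m}}$ is a Euclidean system of ray classes, then $\mathcal{C}$ generates $Cl_K^{\mathfrak{m}}$.
   Context: Notation. $K$ is a number field with ring of integers $\mathfrak{o}_K$. A finite modulus $\mathfrak{m}$ is a non-zero integral ideal of $\mathfrak{o}_K$ (no conditions at infinite places). $J_K^{\mathfrak{m}}$ is the group of fractional ideals of $K$ relatively prime to $\mathfrak{m}$; $P_K^{\mathfrak{m}}$ is its subgroup of principal fractional ideals $(\alpha)$ with $\alpha\in K^\ast$, $\alpha\equiv 1 \pmod{\mathfrak{m}}$ (i.e. $v_{\mathfrak{p}}(\alpha-1)\ge v_{\mathfrak{p}}(\mathfrak{m})$ for all primes $\mathfrak{p}\mid\mathfrak{m}$); $Cl_K^{\mathfrak{m}}=J_K^{\mathfrak{m}}/P_K^{\mathfrak{m}}$. For a set $X$ of fractional ideals (such as $J_K^{\mathfrak m}$, a ray class, or a coset $\mathfrak{a}P_K^{\mathfrak{n}}$), $\text{Int}(X)$ is the set of integral ideals in $X$. $\mathbf{ON}$ is the class of ordinals. For a fractional ideal $\tilde{\mathfrak{c}}$ prime to $\mathfrak{m}$, write $\tilde{\mathfrak{c}}=\mathfrak{a}/\mathfrak{d}$ with coprime integral ideals $\mathfrak{a},\mathfrak{d}$ and put $S_{\mathfrak{m}}(\tilde{\mathfrak{c}})=\mathfrak{d}^{-1}\,\text{Int}(\mathfrak{a}P_K^{\mathfrak{d}\mathfrak{m}})$.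 For $\mathcal{C}=\{C_1,\dots,C_r\}\subset Cl_K^{\mathfrak{m}}$ and $(1)\ne\mathfrak{b}\in\text{Int}(J_K^{\mathfrak{m}})$, $I(\mathcal{C},\mathfrak{b})$ is the set of all $r$-tuples $\left(\tilde{\mathfrak{d}}\prod_{j\ne i}\mathfrak{c}_j\right)_{i=1}^r$ where $\mathfrak{c}_i\in\text{Int}(C_i)$, the ideals $\mathfrak{b},\mathfrak{c}_1,\dots,\mathfrak{c}_r$ are pairwise coprime, and $\tilde{\mathfrak{d}}\in(C_1\cdots C_r)^{-1}$ is a non-integral fractional ideal such that $\tilde{\mathfrak{d}}\mathfrak{b}$ is integral. A function $\varphi:\text{Int}(J_K^{\mathfrak{m}})\to\mathbf{ON}$ is a Euclidean function for $\mathcal{C}$ if for every $(1)\ne\mathfrak{b}\in\text{Int}(J_K^{\mathfrak{m}})$ and every $(\tilde{\mathfrak{c}}_1,\dots,\tilde{\mathfrak{c}}_r)\in I(\mathcal{C},\mathfrak{b})$ there exist $i\in\{1,\dots,r\}$ and $\mathfrak{x}_i\in S_{\mathfrak{m}}(\tilde{\mathfrak{c}}_i)$ with $\varphi(\mathfrak{x}_i\mathfrak{b})<\varphi(\mathfrak{b})$. If such a $\varphi$ exists, $\mathcal{C}$ is called a Euclidean system of ray classes. *)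

(* Defs.v *)
From mathcomp Require Import all_boot all_order all_algebra all_field.
From mathcomp Require Import boolp classical_sets wochoice.

Set Implicit Arguments.
Unset Strict Implicit.
Unset Printing Implicit Defensive.

Import GRing.Theory.
Local Open Scope ring_scope.
Local Open Scope classical_set_scope.

(* Ordinals are represented by well-orders, [R] being the non-strict order.
   Isomorphic well-orders represent the same ordinal; they are interchangeable
   for [on_lt], which compares a well-order with the proper initial segments of
   another one. *)
Record ON := MkON {
  on_sort : Type;
  on_le : rel on_sort;
  on_wo : well_order on_le }.

Definition on_lt (u v : ON) : Prop :=
  exists (b : on_sort v) (f : on_sort u -> on_sort v),
    (forall x y, on_le x y <-> on_le (f x) (f y)) /\
    range f = [set z | on_le z b /\ z <> b].

Section Ideals.
Variable K : fieldExtType rat.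
Implicit Types (I J p m b d : set K) (X Y : set (set K)).

Definition integers : set K :=
  [set x | integralOver (fun z : int => z%:~R : K) x].

Definition fractional_ideal I : Prop :=
  [/\ I 0,
      forall x y, I x -> I y -> I (x + y),
      forall a x, integers a -> I x -> I (a * x),
      exists2 x, I x & x != 0 &
      exists2 a, integers a /\ a != 0 & forall x, I x -> integers (a * x)].

(* In particular integral ideals are non-zero. *)
Definition integral_ideal I : Prop := fractional_ideal I /\ I `<=` integers.

Definition principal_ideal (a : K) : set K := [set a * x | x in integers].

Definition ideal_add I J : set K := [set x + y | x in I & y in J].

Definition ideal_mul I J : set K :=
  [set z | exists (n : nat) (x y : 'I_n -> K),
     [/\ forall k, I (x k), forall k, J (y k) & z = \sum_(k < n) x k * y k]].

Definition ideal_inv I : set K := [set x | forall y, I y -> integers (x * y)].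

Definition ideal_div I J : set K := ideal_mul I (ideal_inv J).

Definition ideal_exp I (n : int) : set K :=
  match n with
  | Posz k => iter k (ideal_mul I) integers
  | Negz k => iter k.+1 (ideal_mul (ideal_inv I)) integers
  end.

Definition coprime_ideals I J : Prop := ideal_add I J = integers.

Definition ideal_dvd I J : Prop :=
  exists2 L, integral_ideal L & J = ideal_mul I L.

Definition prime_ideal p : Prop :=
  [/\ integral_ideal p, p <> integers &
      forall x y, integers x -> integers y -> p (x * y) -> p x \/ p y].

(* The exponent of [p] in the prime factorization of [I]. *)
Definition ideal_val p I : int :=
  xget 0 [set n : int | exists A B : set K,
    [/\ integral_ideal A, integral_ideal B, ~ ideal_dvd p A, ~ ideal_dvd p B &
        I = ideal_mul (ideal_exp p n) (ideal_div A B)]].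

(* The first alternative is the convention that 0 has infinite valuation. *)
Definition cong1 m (a : K) : Prop :=
  a = 1 \/
  forall p, prime_ideal p -> ideal_dvd p m ->
    (ideal_val p m <= ideal_val p (principal_ideal (a - 1)))%R.

Definition prime_to m I : Prop :=
  forall p, prime_ideal p -> ideal_dvd p m -> ideal_val p I = 0.

Definition J_group m : set (set K) :=
  [set I | fractional_ideal I /\ prime_to m I].

Definition P_group m : set (set K) :=
  [set I | exists a : K, [/\ a != 0, cong1 m a & I = principal_ideal a]].

Definition P_coset m I : set (set K) := [set ideal_mul I L | L in P_group m].

(* Ray classes are represented by the cosets themselves, with the elementwise
   product and inverse; the identity is [P_group m]. *)
Definition Cl m : set (set (set K)) := [set P_coset m I | I in J_group m].

Definition class_mul X Y : set (set K) :=
  [set ideal_mul I J | I in X & J in Y].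

Definition class_inv X : set (set K) := [set ideal_inv I | I in X].

Definition Cl_subgroup m (H : set (set (set K))) : Prop :=
  [/\ H `<=` Cl m, H (P_group m),
      forall X Y, H X -> H Y -> H (class_mul X Y) &
      forall X, H X -> H (class_inv X)].

Definition Cl_generated m (S : set (set (set K))) : set (set (set K)) :=
  [set X | forall H, Cl_subgroup m H -> S `<=` H -> H X].

Definition Int X : set (set K) := [set I | X I /\ integral_ideal I].

(* [a] and [d] are uniquely determined by [c]. *)
Definition S_set m (c : set K) : set (set K) :=
  [set x | exists a d : set K,
    [/\ integral_ideal a, integral_ideal d, coprime_ideals a d,
        c = ideal_div a d &
        exists2 y, Int (P_coset (ideal_mul d m) a) y &
                   x = ideal_mul (ideal_inv d) y]].

Definition I_set m (r : nat) (C : 'I_r -> set (set K)) b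
    : set ('I_r -> set K) :=
  [set t | exists (c : 'I_r -> set K) (d : set K),
    [/\ forall i, Int (C i) (c i),
        (forall i, coprime_ideals b (c i)) /\
        (forall i j, i != j -> coprime_ideals (c i) (c j)),
        class_inv (\big[class_mul/P_group m]_(i < r) C i) d,
        ~ integral_ideal d /\ integral_ideal (ideal_mul d b) &
        forall i, t i =
          ideal_mul d (\big[ideal_mul/integers]_(j < r | j != i) c j)]].

(* Only the values of [phi] on [Int (J_group m)] matter: [ideal_mul x b] is
   always one of these ideals. *)
Definition euclidean_function m (r : nat) (C : 'I_r -> set (set K))
    (phi : set K -> ON) : Prop :=
  forall b, Int (J_group m) b -> b <> integers ->
  forall t, I_set m C b t ->
  exists i, exists2 x, S_set m (t i) x & on_lt (phi (ideal_mul x b)) (phi b).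

Definition euclidean_system m (r : nat) (C : 'I_r -> set (set K)) : Prop :=
  exists phi : set K -> ON, euclidean_function m C phi.

End Ideals.

(* Main.v *)
(* Let [H] be a subgroup containing all the [C_i].  By well-founded induction on
   [phi b], the class of every integral ideal [b] prime to [m] is in [H].  For
   [b <> (1)], choose integral [c_i] in [C_i] such that [b], [c_1], ..., [c_r] are
   pairwise coprime, and an integral [e] coprime to [b] in the class of
   [b / (c_1 ... c_r)].  Then [d = e / b] is not integral, so it gives a tuple in
   [I(C, b)], and the Euclidean property yields [x] in the class of
   [d * prod_(j <> i) c_j], which is the class of [c_i^-1], with
   [phi (x b) < phi b].  Hence the class of [b] is that of [(x b) c_i], in [H].
   Every ray class contains an integral ideal, so [H] is everything.

   The finiteness needed for the Dedekind property comes without discriminants: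
   for a prime [l], more than [dim K] integers are linearly dependent modulo [l],
   so [O / l O] is finite.  This gives Noetherian induction on ideals, maximality
   of primes, and integrality of the elements of [K] that stabilize an ideal. *)

Require Import Defs.
From HB Require Import structures.
From mathcomp Require Import all_boot all_order all_algebra all_field.
From mathcomp Require Import boolp classical_sets wochoice ring.

(** * Algebraic integers and finiteness of residue rings *)

Section IntegersTheory.
Set Implicit Arguments.
Unset Strict Implicit.
Unset Printing Implicit Defensive.
Import GRing.Theory Num.Theory Order.TTheory.
Local Open Scope ring_scope.
Local Open Scope classical_set_scope.
Variable K : fieldExtType rat.
Local Notation O := (@integers K).
Implicit Types (x y z : K).

Lemma integers0 : O 0. Proof. exact: (integral0 (intr : int -> K)). Qed.
Lemma integers1 : O 1. Proof. exact: (integral1 (intr : int -> K)). Qed.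
Lemma integersN x : O x -> O (- x).
Proof. exact: (@integral_opp _ _ (intr : int -> K)). Qed.
Lemma integersD x y : O x -> O y -> O (x + y).
Proof. exact: (@integral_add _ _ (intr : int -> K)). Qed.
Lemma integersB x y : O x -> O y -> O (x - y).
Proof. exact: (@integral_sub _ _ (intr : int -> K)). Qed.
Lemma integersM x y : O x -> O y -> O (x * y).
Proof. exact: (@integral_mul _ _ (intr : int -> K)). Qed.
Lemma integers_int (n : int) : O n%:~R.
Proof. exact: (integral_id (intr : int -> K)). Qed.
Lemma integers_nat (n : nat) : O n%:R.
Proof. exact: (integral_nat (intr : int -> K)). Qed.
Lemma integersX x n : O x -> O (x ^+ n).
Proof.
by move=> Ox; elim: n => [|n IHn]; rewrite ?expr0 ?exprS; [apply: integers1|apply: integersM].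
Qed.

Lemma integers_root_monic (p : {poly K}) x :
  p \is monic -> root p x -> (forall i, O p`_i) -> O x.
Proof.
move=> pm px Op; apply: (@integral_root_monic _ _ (intr : int -> K) _ _ pm px).
exact/integral_poly.
Qed.

(** * Characteristic zero and denominators *)

Lemma intr_fieldExt_eq0 (n : int) : ((n%:~R : K) == 0) = (n == 0).
Proof.
rewrite -(rmorph_int (in_alg K)) fmorph_eq0.
by rewrite (intr_eq0 rat_rat__canonical__Num_NumDomain).
Qed.

Lemma natr_fieldExt_eq0 (n : nat) : ((n%:R : K) == 0) = (n == 0)%N.
Proof. by rewrite -[n%:R]/((n : int)%:~R) intr_fieldExt_eq0. Qed.

(** Multiplying the equation of [x] by [a ^ (n-1)], with [a] the leading coefficient, makes it a
    monic equation for [a x] with coefficients [q_i a ^ (n-1-i)]. *)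
Lemma rat_lead_coef_integral (q : {poly int}) x :
  root (map_poly intr q) x -> O ((lead_coef q)%:~R * x).
Proof.
have [->|q0 rx] := eqVneq q 0; first by rewrite lead_coef0 mul0r => _; apply: integers0.
set a := lead_coef q; set n := (size q).-1.
have sq : size q = n.+1 by rewrite /n prednK // lt0n size_poly_eq0.
pose t : {poly K} := \poly_(i < n) ((q`_i)%:~R * a%:~R ^+ (n.-1 - i)).
pose r := 'X^n + t.
have sr : (size t < size ('X^n : {poly K}))%N.
  by rewrite size_polyXn ltnS size_poly.
apply: (@integers_root_monic r).
- by rewrite monicE lead_coefDl // lead_coefXn.
- have n_gt0 : (0 < n)%N.
    rewrite lt0n; apply/eqP => n0; move: rx q0; rewrite n0 in sq.
    have /eqP := sq; rewrite eq_sym => /eqP /esym /eqP /size_poly1P [c c0 ->].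
    by rewrite map_polyC rootC /= intr_fieldExt_eq0 (negPf c0).
  have := rx; rewrite !rootE (@horner_coef_wide _ n.+1); last first.
    by rewrite -sq size_map_poly_id0 // intr_fieldExt_eq0 lead_coef_eq0.
  rewrite /r /t hornerD hornerXn horner_poly big_ord_recr /= coef_map /=.
  rewrite -[q`_n]/(q`_(size q).-1) -lead_coefE -/a => /eqP e.
  apply/eqP.
  transitivity ((a%:~R : K) ^+ n.-1 *
    (\sum_(i < n) (map_poly intr q)`_i * x ^+ i + a%:~R * x ^+ n)); last by rewrite e mulr0.
  rewrite mulrDr addrC mulr_sumr; congr (_ + _).
    apply: eq_bigr => i _; rewrite coef_map /=.
    have -> : (a%:~R : K) ^+ n.-1 = a%:~R ^+ (n.-1 - i) * a%:~R ^+ i.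
      by rewrite -exprD subnK // -ltnS prednK.
    by rewrite exprMn; ring.
  by rewrite exprMn mulrA -exprSr prednK.
- move=> i; rewrite /r /t coefD coefXn coef_poly.
  apply: integersD; first exact: integers_nat.
  case: ifP => _; last exact: integers0.
  by apply: integersM; [|apply: integersX]; apply: integers_int.
Qed.

(** The minimal polynomial is cleared of denominators; the absolute value of the resulting leading
    coefficient serves as [N]. *)
Lemma integers_denominator x : exists2 N, (0 < N)%N & O (N%:R * x).
Proof.
have /polyOver1P[q Dq] := minPolyOver 1 x.
have q0 : q != 0.
  apply/eqP => q0; have := monic_minPoly 1 x.
  by rewrite Dq q0 map_poly0 monicE lead_coef0 eq_sym oner_eq0.
have [p [a a0 Dp]] := rat_poly_scale q.
have p0 : p != 0 by apply: contraNneq q0 => p0; rewrite Dp p0 map_poly0 scaler0.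
have rp : root (map_poly intr p) x.
  have := root_minPoly 1 x; rewrite Dq Dp map_polyZ /= rootZ; last first.
    by rewrite scaler_eq0 oner_eq0 orbF invr_eq0 intr_eq0.
  rewrite -map_poly_comp; congr (root _ x).
  by apply: eq_map_poly => n /=; rewrite -[RHS](rmorph_int (in_alg K)).
exists `|lead_coef p|%N; first by rewrite absz_gt0 lead_coef_eq0.
have := rat_lead_coef_integral rp; rewrite {1}[lead_coef p]intEsign.
rewrite rmorphM /= rmorph_sign -[_%:~R in X in X -> _]/(_%:R) -mulrA.
case: (lead_coef p < 0) => /integersN; first by rewrite expr1 mulN1r opprK.
by rewrite expr0 mul1r => /integersN; rewrite opprK.
Qed.

(* Over Q the elements are dependent; dividing the integral relation by its
   content makes it nontrivial modulo every [l > 1]. *)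
Lemma primitive_dependence (s : seq K) (l : nat) :
  (\dim {:K} < size s)%N -> (1 < l)%N ->
  exists2 c : nat -> int, \sum_(i < size s) (c i)%:~R * s`_i = 0 &
    exists2 i, (i < size s)%N & ~~ (l %| c i)%Z.
Proof.
move=> ds l1; pose n := size s.
have /freeP : ~~ free (in_tuple s).
  rewrite /free neq_ltn; apply/orP; left.
  exact: leq_ltn_trans (dimvS (subvf _)) ds.
move/existsNP => [k /not_implyP [ks /existsNP [i0 /eqP ki0]]].
pose p := rVpoly (\row_i k i).
have pk (i : 'I_n) : p`_i = k i by rewrite coef_rVpoly_ord mxE.
have [q [a a0 Dp]] := rat_poly_scale p.
have q0 : q != 0.
  by apply: contraNneq ki0 => q0; rewrite -pk Dp q0 map_poly0 scaler0 coef0 eqxx.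
have zc0 : zcontents q != 0 by rewrite zcontents_eq0.
pose c i := (zprimitive q)`_i.
have kc (i : 'I_n) : k i = (zcontents q)%:~R / a%:~R * (c i)%:~R.
  rewrite -pk Dp coefZ coef_map /= {1}[q]zpolyEprim coefZ rmorphM /=.
  by rewrite mulrCA mulrA.
exists c.
  have : ((zcontents q)%:~R / a%:~R) *: \sum_(i < n) (c i)%:~R * s`_i = 0.
    rewrite -[RHS]ks scaler_sumr; apply: eq_bigr => i _.
    by rewrite kc -[RHS]scalerA -(rmorph_int (in_alg K) (c i)) /= mulr_algl.
  by move/eqP; rewrite scaler_eq0 mulf_eq0 invr_eq0 !intr_eq0 (negPf zc0) (negPf a0) => /eqP.
apply: contrapT => H.
have : (l %| zcontents (zprimitive q))%Z.
  rewrite dvdz_contents; apply/polyOverP => i.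
  have [ltin|leni] := ltnP i n.
    by apply/negPn/negP => nl; apply: H; exists i.
  rewrite nth_default ?dvdz0 // size_zprimitive.
  apply: leq_trans leni; have : (size p <= n)%N by apply: size_poly.
  by rewrite Dp size_scale ?invr_eq0 ?intr_eq0 // size_rat_int_poly.
by rewrite zcontents_primitive q0 dvdz1 absz_nat => /eqP l1'; rewrite l1' in l1.
Qed.

(** For a prime [l], this and [free_mod] are spanning and independence over the field with [l]
    elements in [O / l O], written without the quotient. *)
Definition spans_mod (l : nat) (s : seq K) : Prop :=
  forall x, O x -> exists (c : nat -> int) w,
    O w /\ x = \sum_(i < size s) (c i)%:~R * s`_i + l%:R * w.

Definition free_mod (l : nat) (s : seq K) : Prop :=
  forall (c : nat -> int) w, O w ->
    \sum_(i < size s) (c i)%:~R * s`_i = l%:R * w ->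
    forall i, (i < size s)%N -> (l %| c i)%Z.

(** A coefficient of [x] not divisible by [l] would be invertible modulo [l], and the relation would
    express [x] through [s]. *)
Lemma free_mod_cons l s x :
  prime l -> O x -> free_mod l s ->
  ~ (exists (c : nat -> int) w,
      O w /\ x = \sum_(i < size s) (c i)%:~R * s`_i + l%:R * w) ->
  free_mod l (x :: s).
Proof.
move=> pl Ox fs nx c w Ow; rewrite big_ord_recl /= => e.
have c0 : (l %| c 0%N)%Z.
  apply: contrapT => /negP nl; apply: nx.
  have /coprimezP[[u v] /= uv] : coprimez (c 0%N) l.
    by rewrite coprimez_sym coprimezE prime_coprime // -dvdzE.
  exists (fun i => - u * c i.+1), (u%:~R * w + v%:~R * x); split.
    by apply: integersD; apply: integersM => //; apply: integers_int.
  have uvK : u%:~R * (c 0%N)%:~R + v%:~R * l%:R = 1 :> K.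
    by rewrite -[l%:R]/((l : int)%:~R) -!intrM -intrD uv.
  under eq_bigr => i _ do rewrite rmorphM /= -mulrA.
  rewrite -mulr_sumr rmorphN /=.
  have -> : \sum_(i < size s) (c i.+1)%:~R * s`_i = l%:R * w - (c 0%N)%:~R * x.
    by rewrite -e addrC addKr.
  transitivity ((u%:~R * (c 0%N)%:~R + v%:~R * l%:R) * x); last by ring.
  by rewrite uvK mul1r.
have [q cq] := dvdzP c0.
have e' : \sum_(i < size s) (c i.+1)%:~R * s`_i = l%:R * (w - q%:~R * x).
  apply: (addrI ((c 0%N)%:~R * x)); rewrite e cq intrM -[l%:~R]/(l%:R); ring.
case=> [|i] //; rewrite ltnS => ls.
apply: (fs (fun i => c i.+1) _ _ e' i ls); apply: integersB => //.
by apply: integersM => //; apply: integers_int.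
Qed.

(** An independent family that does not span can be lengthened, while [primitive_dependence] bounds
    its length by the dimension. *)
Lemma spans_mod_exists l : prime l ->
  exists2 s : seq K, (forall y, y \in s -> O y) & spans_mod l s.
Proof.
move=> pl.
(* [k] counts the additions that would bring the length to one more than the dimension. *)
suff H k : forall s, (size s + k = (\dim {:K}).+1)%N -> free_mod l s ->
    (forall y, y \in s -> O y) ->
  exists2 s : seq K, (forall y, y \in s -> O y) & spans_mod l s.
  by apply: (H _ [::]) => //; apply: add0n.
elim: k => [|k IHk] s ss fs Os.
  have ls : (\dim {:K} < size s)%N by rewrite -ss addn0.
  have [c e [i li /negP []]] := primitive_dependence ls (prime_gt1 pl).
  by apply: (fs c 0) => //; rewrite ?e ?mulr0 //; apply: integers0.
have [sp|nsp] := pselect (spans_mod l s); first by exists s.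
have /existsNP [x /not_implyP [Ox nx]] := nsp.
apply: (IHk (x :: s)); first by rewrite /= addSnnS.
  exact: free_mod_cons.
by move=> y; rewrite inE => /predU1P[->//|]; apply: Os.
Qed.

Definition finite_residues (N : nat) : Prop :=
  exists2 s : seq K, (forall y, y \in s -> O y) &
    forall x, O x -> exists y w, [/\ y \in s, O w & x = y + N%:R * w].

(** Reducing the coefficients to remainders modulo [l] leaves finitely many combinations. *)
Lemma combinations_mod l (s : seq K) : (0 < l)%N ->
  (forall y, y \in s -> O y) ->
  exists2 t : seq K, (forall y, y \in t -> O y) &
    forall c : nat -> int, exists y w,
      [/\ y \in t, O w & \sum_(i < size s) (c i)%:~R * s`_i = y + l%:R * w].
Proof.
move=> l0; elim: s => [|a s IHs] Os.
  exists [:: 0] => [y|c]; first by rewrite inE => /eqP ->; apply: integers0.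
  exists 0, 0; rewrite inE eqxx big_ord0 mulr0 addr0.
  by split=> //; apply: integers0.
have Oa : O a by apply: Os; rewrite mem_head.
have [t Ot Ht] : exists2 t : seq K, (forall y, y \in t -> O y) &
    forall c : nat -> int, exists y w,
      [/\ y \in t, O w & \sum_(i < size s) (c i)%:~R * s`_i = y + l%:R * w].
  by apply: IHs => y ys; apply: Os; rewrite inE ys orbT.
exists [seq j%:R * a + y | j <- iota 0 l, y <- t].
  move=> z /allpairsP [[j y] /= [_ yt ->]].
  by apply: integersD; [apply: integersM => //; apply: integers_nat | apply: Ot].
move=> c; have [y [w [yt Ow e]]] := Ht (fun i => c i.+1).
have lz : (l : int) != 0 by rewrite -lt0n.
have [r Dr] : exists r : nat, (c 0%N %% l)%Z = r.
  by exists `|(c 0%N %% l)%Z|%N; rewrite gez0_abs // modz_ge0.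
have rl : (r < l)%N by rewrite -ltz_nat -Dr ltz_pmod.
exists (r%:R * a + y), ((c 0%N %/ l)%Z%:~R * a + w); split.
- by apply/allpairsP; exists (r, y); rewrite /= mem_iota.
- by apply: integersD => //; apply: integersM => //; apply: integers_int.
rewrite big_ord_recl /= e {1}(divz_eq (c 0%N) l) Dr intrD intrM.
rewrite -[l%:~R]/(l%:R) -[r%:~R]/(r%:R); ring.
Qed.

Lemma finite_residues_prime l : prime l -> finite_residues l.
Proof.
move=> pl; have [s Os sps] := spans_mod_exists pl.
have [t Ot Ht] := combinations_mod (prime_gt0 pl) Os.
exists t => // x /sps [c [w [Ow ->]]].
have [y [w' [yt Ow' ->]]] := Ht c.
exists y, (w' + w); split => //; first exact: integersD.
by rewrite mulrDr addrA.
Qed.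

Lemma finite_residues_mul N M :
  finite_residues N -> finite_residues M -> finite_residues (N * M).
Proof.
move=> [s Os Hs] [t Ot Ht]; exists [seq y + N%:R * z | y <- s, z <- t].
  move=> _ /allpairsP [[y z] /= [ys zt ->]].
  by apply: integersD; [apply: Os|apply: integersM; [apply: integers_nat|apply: Ot]].
move=> x /Hs [y [w [ys /Ht [z [w' [zt Ow' ->]]] ->]]].
exists (y + N%:R * z), w'; split=> //; last by rewrite natrM; ring.
by apply/allpairsP; exists (y, z).
Qed.

Lemma finite_residues_gt0 N : (0 < N)%N -> finite_residues N.
Proof.
have [n] := ubnP N; elim: n N => // n IHn N ltNn N0.
have [N1|N1] := leqP N 1.
  have -> : N = 1%N by apply/eqP; rewrite eqn_leq N1.
  exists [:: 0] => [y|x Ox]; first by rewrite inE => /eqP ->; apply: integers0.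
  by exists 0, x; rewrite inE eqxx add0r mul1r.
have pp := pdiv_prime N1; have pdN := pdiv_dvd N.
rewrite -(divnK pdN); apply: finite_residues_mul; last exact: finite_residues_prime.
apply: IHn; last by rewrite divn_gt0 ?pdiv_gt0 // dvdn_leq.
by apply: leq_trans (ltn_Pdiv (prime_gt1 pp) N0) _; rewrite -ltnS.
Qed.

(** Pigeonhole principle, on one more term than there are representatives modulo [N]. *)
Lemma congruent_pair N (f : nat -> K) : (0 < N)%N -> (forall k, O (f k)) ->
  exists i j w, [/\ (i < j)%N, O w & f j - f i = N%:R * w].
Proof.
move=> N0 Of; have [s Os Hs] := finite_residues_gt0 N0.
have /choice [g Hg] : forall k, exists y, y \in s /\
    exists2 w, O w & f k = y + N%:R * w.
  by move=> k; have [y [w [ys Ow e]]] := Hs _ (Of k); exists y; split=> //; exists w.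
have : ~~ uniq [seq g k | k <- iota 0 (size s).+1].
  apply/negP => /uniq_leq_size => /(_ s) /=.
  rewrite size_map size_iota ltnn => H.
  by apply: notF; apply: H => y /(mapP (s := iota 0 (size s).+1)) [k _ ->]; case: (Hg k).
move/(uniqPn 0) => [i [j [ij]]]; rewrite size_map size_iota => jn.
rewrite !(nth_map 0%N) ?size_iota //; last exact: ltn_trans jn.
rewrite !nth_iota ?add0n // => [gij|]; last exact: ltn_trans jn.
have [_ [u Ou eu]] := Hg i; have [_ [v Ov ev]] := Hg j.
exists i, j, (v - u); split=> //; first exact: integersB.
by rewrite eu ev gij; ring.
Qed.

(** Two of the elements [N x^k] are congruent modulo [N]; cancelling [N] makes [x] a root of the
    monic polynomial [X^j - X^i - w] over [O]. *)
Lemma integers_almost_integral x N :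
  (0 < N)%N -> (forall k, O (N%:R * x ^+ k)) -> O x.
Proof.
move=> N0 ON; have [i [j [w [ltij Ow e0]]]] := congruent_pair N0 ON.
have NK : (N%:R : K) != 0 by rewrite natr_fieldExt_eq0 -lt0n.
have e : x ^+ j - x ^+ i = w by apply: (mulfI NK); rewrite -e0 mulrBr.
pose t : {poly K} := - 'X^i - w%:P.
have st : (size t < size ('X^j : {poly K}))%N.
  rewrite size_polyXn ltnS (leq_trans (size_polyD _ _)) // geq_max.
  rewrite size_polyN size_polyXn ltij size_polyN size_polyC.
  by apply: leq_trans (leq_b1 _) _; apply: leq_ltn_trans ltij.
apply: (@integers_root_monic ('X^j + t)).
- by rewrite monicE lead_coefDl // lead_coefXn.
- by rewrite rootE /t !(hornerD, hornerN, hornerXn, hornerC) -e; apply/eqP; ring.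
- move=> k; rewrite /t coefD coefB coefN !coefXn coefC.
  apply: integersD; first exact: integers_nat.
  apply: integersB; first by apply/integersN/integers_nat.
  by case: eqP => _ //; apply: integers0.
Qed.

End IntegersTheory.

(** * Invertibility of fractional ideals *)

Lemma ltn_count (T : eqType) (a b : pred T) (s : seq T) (y : T) :
  subpred a b -> y \in s -> ~~ a y -> b y -> (count a s < count b s)%N.
Proof.
move=> sab ys nay bY; elim: s ys => // x s IHs; rewrite inE => /predU1P[<-|/IHs ltab] /=.
  by rewrite (negPf nay) bY add0n add1n ltnS sub_count.
by rewrite -addnS leq_add //; case: (boolP (a x)) => // /sab ->.
Qed.

Section IdealTheory.
Set Implicit Arguments.
Unset Strict Implicit.
Unset Printing Implicit Defensive.
Import GRing.Theory.
Local Open Scope ring_scope.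
Local Open Scope classical_set_scope.
Variable K : fieldExtType rat.
Local Notation O := (@integers K).
Implicit Types (x y z a b : K) (I J L p : set K).

(** * Arithmetic of products, inverses and sums *)

Lemma mem_ideal_mul I J x y : I x -> J y -> ideal_mul I J (x * y).
Proof.
by move=> Ix Jy; exists 1%N, (fun=> x), (fun=> y); split; rewrite ?big_ord1.
Qed.

Lemma ideal_mul0 I J : ideal_mul I J 0.
Proof.
by exists 0%N, (fun=> 0), (fun=> 0); split; rewrite ?big_ord0 // => -[].
Qed.

Lemma ideal_mulD I J x y :
  ideal_mul I J x -> ideal_mul I J y -> ideal_mul I J (x + y).
Proof.
move=> [n [u [v [Iu Jv ->]]]] [n' [u' [v' [Iu' Jv' ->]]]].
pose w T (f : 'I_n -> T) (g : 'I_n' -> T) (i : 'I_(n + n')) :=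
  match split i with inl j => f j | inr j => g j end.
exists (n + n')%N, (w _ u u'), (w _ v v'); split.
- by rewrite /w => k; case: (split k).
- by rewrite /w => k; case: (split k).
rewrite big_split_ord /=; congr (_ + _); apply: eq_bigr => i _; rewrite /w.
  by rewrite (unsplitK (inl _ i)).
by rewrite (unsplitK (inr _ i)).
Qed.

Lemma ideal_mul_sub I J L : L 0 -> (forall x y, L x -> L y -> L (x + y)) ->
  (forall x y, I x -> J y -> L (x * y)) -> ideal_mul I J `<=` L.
Proof.
move=> L0 LD LM _ [n [u [v [Iu Jv ->]]]].
by elim/big_rec: _ => // i x _; apply: LD; apply: LM.
Qed.

Lemma ideal_mulS I I' J J' :
  I `<=` I' -> J `<=` J' -> ideal_mul I J `<=` ideal_mul I' J'.
Proof.
move=> sI sJ; apply: ideal_mul_sub; [exact: ideal_mul0|exact: ideal_mulD|].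
by move=> x y /sI Ix /sJ Jy; apply: mem_ideal_mul.
Qed.

Lemma ideal_mulC I J : ideal_mul I J = ideal_mul J I.
Proof.
suff S I' J' : ideal_mul I' J' `<=` ideal_mul J' I' by apply/seteqP; split.
apply: ideal_mul_sub; [exact: ideal_mul0|exact: ideal_mulD|].
by move=> x y Ix Jy; rewrite mulrC; apply: mem_ideal_mul.
Qed.

Lemma ideal_mulA I J L : ideal_mul I (ideal_mul J L) = ideal_mul (ideal_mul I J) L.
Proof.
have S I' J' L' : ideal_mul I' (ideal_mul J' L') `<=` ideal_mul (ideal_mul I' J') L'.
  apply: ideal_mul_sub; [exact: ideal_mul0|exact: ideal_mulD|].
  move=> x _ Ix [n [u [v [Iu Jv ->]]]]; rewrite mulr_sumr.
  elim/big_rec: _ => [|i z _]; first exact: ideal_mul0.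
  apply: ideal_mulD; rewrite mulrA; apply: mem_ideal_mul => //.
  exact: mem_ideal_mul.
apply/seteqP; split=> //.
by rewrite [X in X `<=` _]ideal_mulC [ideal_mul I J]ideal_mulC
  [X in _ `<=` X]ideal_mulC [ideal_mul J L]ideal_mulC.
Qed.

(** The closure properties shared by fractional ideals, principal ideals of any generator and
    [ideal_inv] of any set. *)
Definition submodule I : Prop :=
  [/\ I 0, forall x y, I x -> I y -> I (x + y) & forall a x, O a -> I x -> I (a * x)].

Lemma fractional_submodule I : fractional_ideal I -> submodule I.
Proof. by case. Qed.

Lemma integral_submodule I : integral_ideal I -> submodule I.
Proof. by case=> /fractional_submodule. Qed.

Lemma integralP I : integral_ideal I <->
  [/\ submodule I, I `<=` O & exists2 x, I x & x != 0].
Proof.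
split=> [[[I0 ID IM nI _] sI]|[[I0 ID IM] sI nI]] //; split=> //; split=> //.
exists 1; first by split; [apply: integers1|apply: oner_neq0].
by move=> x /sI; rewrite mul1r.
Qed.

Lemma submoduleB I x y : submodule I -> I x -> I y -> I (x - y).
Proof.
case=> I0 ID IM Ix Iy; apply: ID => //; rewrite -mulN1r; apply: IM => //.
exact/integersN/integers1.
Qed.

Lemma integers_submodule : submodule O.
Proof. by split; [apply: integers0|apply: integersD|apply: integersM]. Qed.

Lemma integers_integral : integral_ideal O.
Proof.
apply/integralP; split=> //; first exact: integers_submodule.
by exists 1; [apply: integers1|apply: oner_neq0].
Qed.

Lemma ideal_mul_submodule I J : submodule I -> submodule (ideal_mul I J).
Proof.
move=> [I0 ID IM]; split; [exact: ideal_mul0|exact: ideal_mulD|].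
move=> a _ Oa [n [u [v [Iu Jv ->]]]]; exists n, (fun i => a * u i), v; split=> //.
  by move=> k; apply: IM.
by rewrite mulr_sumr; apply: eq_bigr => i _; rewrite mulrA.
Qed.

Lemma ideal_mul1 I : submodule I -> ideal_mul O I = I.
Proof.
move=> [I0 ID IM]; apply/seteqP; split; first exact: ideal_mul_sub.
by move=> x Ix; rewrite -[x]mul1r; apply: mem_ideal_mul => //; apply: integers1.
Qed.

Lemma submodule_eq1 I : submodule I -> I `<=` O -> I 1 -> I = O.
Proof.
move=> [_ _ IM] sI I1; apply/seteqP; split=> // x Ox.
by rewrite -[x]mulr1; apply: IM.
Qed.

Lemma fractional_mul I J :
  fractional_ideal I -> fractional_ideal J -> fractional_ideal (ideal_mul I J).
Proof.
move=> fI fJ.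
have [_ _ _ [x Ix x0] [a [Oa a0] aI]] := fI.
have [_ _ _ [y Jy y0] [b [Ob b0] bJ]] := fJ.
have [M0 MD MM] := ideal_mul_submodule J (fractional_submodule fI).
split=> //; first by exists (x * y); [apply: mem_ideal_mul|apply: mulf_neq0].
exists (a * b); first by split; [apply: integersM|apply: mulf_neq0].
apply: (ideal_mul_sub (L := [set z | O (a * b * z)])) => /=.
- by rewrite mulr0; apply: integers0.
- by move=> u v Ou Ov; rewrite mulrDr; apply: integersD.
- by move=> u v /aI Ou /bJ Ov; rewrite mulrACA; apply: integersM.
Qed.

Lemma integral_mul I J :
  integral_ideal I -> integral_ideal J -> integral_ideal (ideal_mul I J).
Proof.
move=> [fI sI] [fJ sJ]; split; first exact: fractional_mul.
apply: ideal_mul_sub; [exact: integers0|exact: integersD|].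
by move=> x y /sI Ox /sJ Oy; apply: integersM.
Qed.

Lemma ideal_inv_submodule I : submodule (ideal_inv I).
Proof.
split=> [y _|x x' Hx Hx' y Iy|a x Oa Hx y Iy].
- by rewrite mul0r; apply: integers0.
- by rewrite mulrDl; apply: integersD; [apply: Hx|apply: Hx'].
- by rewrite -mulrA; apply: integersM => //; apply: Hx.
Qed.

(** A common denominator [a] of [I] is a non-zero element of the inverse; for a non-zero [x] in [I],
    the integer [a * x] clears the denominators of the inverse. *)
Lemma fractional_inv I : fractional_ideal I -> fractional_ideal (ideal_inv I).
Proof.
move=> [I0 ID IM [x Ix x0] [a [Oa a0] aI]].
have [V0 VD VM] := ideal_inv_submodule I.
split=> //; first by exists a.
exists (a * x); first by split; [apply: aI|apply: mulf_neq0].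
by move=> y Hy; rewrite mulrC; apply: Hy; apply: IM.
Qed.

Lemma principal_submodule a : submodule (principal_ideal a).
Proof.
split; first by exists 0; [apply: integers0|rewrite mulr0].
- by move=> _ _ [u Ou <-] [v Ov <-]; exists (u + v); [apply: integersD|rewrite mulrDr].
- by move=> b _ Ob [u Ou <-]; exists (b * u); [apply: integersM|rewrite mulrCA].
Qed.

Lemma mem_principal a : principal_ideal a a.
Proof. by exists 1; [apply: integers1|rewrite mulr1]. Qed.

Lemma fractional_principal a : a != 0 -> fractional_ideal (principal_ideal a).
Proof.
move=> a0; have [P0 PD PM] := principal_submodule a; split=> //.
  by exists a => //; apply: mem_principal.
have [N N0 ON] := integers_denominator a.
exists N%:R; first by rewrite natr_fieldExt_eq0 -lt0n; split=> //; apply: integers_nat.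
by move=> _ [u Ou <-]; rewrite mulrA; apply: integersM.
Qed.

Lemma ideal_mul_principal a I : submodule I ->
  ideal_mul (principal_ideal a) I = [set a * x | x in I].
Proof.
move=> [I0 ID IM]; apply/seteqP; split.
  apply: ideal_mul_sub; first by exists 0; rewrite ?mulr0.
    by move=> _ _ [x Ix <-] [y Iy <-]; exists (x + y); rewrite ?mulrDr //; apply: ID.
  by move=> _ y [u Ou <-] Iy; exists (u * y); rewrite ?mulrA //; apply: IM.
by move=> _ [x Ix <-]; apply: mem_ideal_mul => //; apply: mem_principal.
Qed.

Lemma integral_principal a : a != 0 -> O a -> integral_ideal (principal_ideal a).
Proof.
move=> a0 Oa; split; first exact: fractional_principal.
by move=> _ [u Ou <-]; apply: integersM.
Qed.

Lemma submodule_add I J : submodule I -> submodule J -> submodule (ideal_add I J).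
Proof.
move=> [I0 ID IM] [J0 JD JM]; split.
- by exists 0 => //; exists 0; rewrite ?addr0.
- move=> _ _ [x Ix [y Jy <-]] [x' Ix' [y' Jy' <-]].
  by exists (x + x'); [apply: ID|exists (y + y'); [apply: JD|rewrite addrACA]].
- move=> a _ Oa [x Ix [y Jy <-]].
  by exists (a * x); [apply: IM|exists (a * y); [apply: JM|rewrite mulrDr]].
Qed.

Lemma ideal_add_subl I J : submodule J -> I `<=` ideal_add I J.
Proof. by move=> [J0 _ _] x Ix; exists x => //; exists 0; rewrite ?addr0. Qed.

Lemma ideal_add_subr I J : submodule I -> J `<=` ideal_add I J.
Proof. by move=> [I0 _ _] x Jx; exists 0 => //; exists x; rewrite ?add0r. Qed.

Lemma ideal_add_sub I J L : submodule L -> I `<=` L -> J `<=` L -> ideal_add I J `<=` L.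
Proof. by move=> [_ LD _] sI sJ _ [x /sI Ix [y /sJ Jy <-]]; apply: LD. Qed.

Lemma integral_add_ideal I J :
  integral_ideal I -> submodule J -> J `<=` O -> integral_ideal (ideal_add I J).
Proof.
move=> /integralP [mI sI [x Ix x0]] mJ sJ; apply/integralP; split.
- exact: submodule_add.
- exact: ideal_add_sub integers_submodule sI sJ.
- by exists x => //; apply: ideal_add_subl.
Qed.

(** [N] is chosen with [N / x] integral for a non-zero [x] in [I]; then [N = (N / x) x]. *)
Lemma integral_has_nat I : integral_ideal I -> exists2 N, (0 < N)%N & I N%:R.
Proof.
move=> [[I0 ID IM [x Ix x0] _] sI].
have [N N0 ON] := integers_denominator x^-1; exists N => //.
by rewrite -(mulfVK x0 N%:R); apply: IM.
Qed.

(* An ideal containing [N] is determined by which of the finitely many residues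
   mod [N] it contains, so the number of missing residues decreases. *)
Lemma noetherian_ind (Q : set K -> Prop) :
  (forall I, integral_ideal I ->
     (forall J, integral_ideal J -> I `<=` J -> J <> I -> Q J) -> Q I) ->
  forall I, integral_ideal I -> Q I.
Proof.
move=> H I0 iI0; have [N N0 IN] := integral_has_nat iI0.
have [s Os Hs] := finite_residues_gt0 K N0.
pose c I := count (fun y => `[< I y >]) s.
suff G n : forall I, integral_ideal I -> I N%:R -> (size s - c I < n)%N -> Q I.
  exact: (G _ I0 iI0 IN (ltnSn _)).
elim: n => // n IHn I iI IN' cn; apply: H => // J iJ IJ nIJ.
have JN := IJ _ IN'.
apply: IHn => //.
have [x [Jx nIx]] : exists x, J x /\ ~ I x.
  apply: contrapT => nx; apply: nIJ; apply/seteqP; split=> // x Jx.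
  by apply: contrapT => nIx; apply: nx; exists x.
have mI := integral_submodule iI; have mJ := integral_submodule iJ.
have sNw L w : submodule L -> L N%:R -> O w -> L (N%:R * w).
  by move=> [_ _ LM] LN Ow; rewrite mulrC; apply: LM.
(* The representative [y] differs from [x] by a multiple of [N], which both ideals contain, so [y]
   separates them as [x] does. *)
have [y [w [ys Ow e]]] := Hs x (iJ.2 _ Jx).
have Jy : J y by rewrite -[y](addrK (N%:R * w)) -e; apply: submoduleB => //; apply: sNw.
have nIy : ~ I y.
  by have [_ ID _] := mI; move=> Iy; apply: nIx; rewrite e; apply: ID => //; apply: sNw.
suff cIJ : (c I < c J)%N.
  have cJ : (c J <= size s)%N by apply: count_size.
  by rewrite -ltnS; apply: leq_trans cn; rewrite ltnS ltn_sub2l // (leq_trans cIJ).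
apply: ltn_count ys _ _ => //.
- by move=> z /asboolP /IJ Jz; apply/asboolP.
- by apply/asboolPn.
- by apply/asboolP.
Qed.

(** Noetherian induction passes to a larger proper ideal if there is one; otherwise [I] is maximal,
    hence prime. *)
Lemma exists_prime_above I : integral_ideal I -> I <> O ->
  exists2 p, prime_ideal p & I `<=` p.
Proof.
move: I; apply: (@noetherian_ind (fun I => I <> O -> exists2 p, prime_ideal p & I `<=` p)).
move=> I iI IHI nI.
have [[J [iJ IJ nIJ nJ]]|mx] :=
  pselect (exists J, [/\ integral_ideal J, I `<=` J, J <> I & J <> O]).
  by have [p pp Jp] := IHI J iJ IJ nIJ nJ; exists p => //; apply: subset_trans IJ Jp.
exists I => //; split=> // x y Ox Oy Ixy.
have [Ix|nIx] := pselect (I x); first by left.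
right; have mI := integral_submodule iI; have mx' := principal_submodule x.
have [_ ID IM] := mI.
have : ideal_add I (principal_ideal x) = O.
  apply: contrapT => nO; apply: mx; exists (ideal_add I (principal_ideal x)); split=> //.
  - by apply: integral_add_ideal => // _ [u Ou <-]; apply: integersM.
  - exact: ideal_add_subl.
  - by move=> e; apply: nIx; rewrite -e; apply: ideal_add_subr => //; apply: mem_principal.
move/seteqP => [_ /(_ 1 (integers1 K))] [u Iu [_ [v Ov <-] e]].
rewrite -[y]mul1r -e mulrDl; apply: ID; first by rewrite mulrC; apply: IM.
by rewrite [x * v]mulrC -mulrA; apply: IM.
Qed.

(** For [x] in [J] outside [p], two powers of [x] are congruent modulo [p]; by primality
    [x^(j-i) - 1] is in [p], and then 1 is in [J]. *)
Lemma prime_maximal p J : prime_ideal p -> integral_ideal J -> p `<=` J -> J <> p -> J = O.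
Proof.
move=> [ip np pM] iJ pJ nJp.
have [x Jx npx] : exists2 x, J x & ~ p x.
  apply: contrapT => nx; apply: nJp; apply/seteqP; split=> // x Jx.
  by apply: contrapT => nIx; apply: nx; exists x.
have Ox := iJ.2 _ Jx.
have [N N0 pN] := integral_has_nat ip.
have OX k : O (x ^+ k) by apply: integersX.
have [i [j [w [ij Ow e]]]] := congruent_pair N0 OX.
have [_ _ pMl] := integral_submodule ip.
have : p (x ^+ i * (x ^+ (j - i) - 1)).
  by rewrite mulrBr mulr1 -exprD subnKC 1?ltnW // e mulrC; apply: pMl.
have npX k : ~ p (x ^+ k).
  elim: k => [|k IHk].
    by rewrite expr0 => p1; apply: np; apply: submodule_eq1 ip.2 p1; apply: integral_submodule.
  by rewrite exprS => /(pM _ _ Ox (OX k)) [].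
move/pM => [||/npX //|p1]; [exact: OX|by apply: integersB => //; apply: integers1|].
have mJ := integral_submodule iJ; apply: submodule_eq1 iJ.2 _ => //.
rewrite -[1](subKr (x ^+ (j - i))); apply: submoduleB => //; last exact: pJ.
have [_ _ JM] := mJ.
by rewrite -(prednK (n := j - i)) ?subn_gt0 // exprSr; apply: JM.
Qed.

Lemma prime_mul_sub p I J : prime_ideal p -> I `<=` O -> J `<=` O ->
  ideal_mul I J `<=` p -> I `<=` p \/ J `<=` p.
Proof.
move=> [ip np pM] sI sJ IJp; have [?|/existsNP [x /not_implyP [Ix npx]]] := pselect (I `<=` p).
  by left.
right=> y Jy; have := IJp _ (mem_ideal_mul Ix Jy).
by move/pM => [||//|//]; [apply: sI|apply: sJ].
Qed.

(** * Products of primes and invertibility *)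

Definition ideal_prod (ps : seq (set K)) := foldr (@ideal_mul K) O ps.
Definition primes_seq (ps : seq (set K)) := forall q, q \in ps -> prime_ideal q.

Lemma ideal_prod_integral ps : primes_seq ps -> integral_ideal (ideal_prod ps).
Proof.
elim: ps => [|p ps IHps] pp /=; first exact: integers_integral.
apply: integral_mul; first by have [] := pp p (mem_head _ _).
by apply: IHps => q qps; apply: pp; rewrite inE qps orbT.
Qed.

Lemma ideal_prod_cat ps qs : primes_seq qs ->
  ideal_prod (ps ++ qs) = ideal_mul (ideal_prod ps) (ideal_prod qs).
Proof.
move=> pq; elim: ps => [|p ps IHps] /=; last by rewrite IHps ideal_mulA.
by rewrite ideal_mul1 //; apply/integral_submodule/ideal_prod_integral.
Qed.

(** If [x y] is in [I] but neither factor is, the larger ideals [I + (x)] and [I + (y)] contain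
    products of primes, and [I] contains the product of these two ideals. *)
Lemma exists_prime_product I : integral_ideal I ->
  exists2 ps, primes_seq ps & ideal_prod ps `<=` I.
Proof.
move: I; apply: noetherian_ind => I iI IHI.
have mI := integral_submodule iI; have [_ ID IM] := mI.
have [->|nI] := pselect (I = O); first by exists [::].
have [pI|npI] := pselect (prime_ideal I).
  exists [:: I]; first by move=> q; rewrite inE => /eqP ->.
  by rewrite /= ideal_mulC ideal_mul1.
have [x [y [Ox Oy Ixy nIx nIy]]] :
    exists x y, [/\ O x, O y, I (x * y), ~ I x & ~ I y].
  apply: contrapT => nxy; apply: npI; split=> // x y Ox Oy Ixy.
  have [Ix|nIx] := pselect (I x); first by left.
  have [Iy|nIy] := pselect (I y); first by right.
  by case: nxy; exists x, y.
have G z : O z -> ~ I z ->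
    exists2 ps, primes_seq ps & ideal_prod ps `<=` ideal_add I (principal_ideal z).
  move=> Oz nIz; have mz := principal_submodule z; apply: IHI.
  - by apply: integral_add_ideal => // _ [u Ou <-]; apply: integersM.
  - exact: ideal_add_subl.
  - by move=> e; apply: nIz; rewrite -e; apply: ideal_add_subr => //; apply: mem_principal.
have [ps pps sps] := G x Ox nIx; have [qs pqs sqs] := G y Oy nIy.
exists (ps ++ qs).
  by move=> q; rewrite mem_cat => /orP [/pps|/pqs].
rewrite ideal_prod_cat //; apply: subset_trans (ideal_mulS sps sqs) _.
apply: ideal_mul_sub => //; first by case: mI.
move=> _ _ [i Ii [_ [u Ou <-] <-]] [j Ij [_ [v Ov <-] <-]].
have -> : (i + x * u) * (j + y * v)
  = (j + y * v) * i + (x * u) * j + (u * v) * (x * y) by ring.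
have Oj := iI.2 _ Ij.
apply: (ID _ _ (ID _ _ _ _)); apply: IM => //; last exact: integersM.
  by apply: integersD => //; apply: integersM.
by apply: integersM.
Qed.

(** By primality [p] contains one of the factors, and by maximality it equals that factor. The bound
    on [qs] serves a descent on the length. *)
Lemma prime_above_product p ps : prime_ideal p -> primes_seq ps -> ideal_prod ps `<=` p ->
  p \in ps /\ exists qs, [/\ primes_seq qs, (size qs < size ps)%N &
    ideal_prod ps = ideal_mul p (ideal_prod qs)].
Proof.
move=> pp; elim: ps => [|q ps IHps] pps /= sp.
  by have [ip np _] := pp; case: np; apply/seteqP; split=> //; case: ip.
have pq : prime_ideal q by apply: pps; rewrite mem_head.
have pps' : primes_seq ps by move=> r rps; apply: pps; rewrite inE rps orbT.
have [iq nq _] := pq; have [ip _ _] := pp.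
have [qp|psp] : q `<=` p \/ ideal_prod ps `<=` p.
  by apply: prime_mul_sub pp _ _ sp; [case: iq|case: (ideal_prod_integral pps')].
  have <- : p = q.
    apply: contrapT => nqp; have [_ np _] := pp; apply: np.
    exact: (prime_maximal pq).
  by split; [rewrite mem_head|exists ps].
have [pin [qs [pqs sqs e]]] := IHps pps' psp.
split; [by rewrite inE pin orbT | exists (q :: qs); split=> //].
  by move=> r; rewrite inE => /predU1P[->//|]; apply: pqs.
by rewrite /= e !ideal_mulA [ideal_mul q p]ideal_mulC.
Qed.

(** For a positive integer [N] in [I], all the elements [N x^k] stay in [I], hence in [O]. *)
Lemma ideal_stabilizer_integral I x : integral_ideal I ->
  (forall y, I y -> I (x * y)) -> O x.
Proof.
move=> iI xI; have [N N0 IN] := integral_has_nat iI.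
apply: (integers_almost_integral N0) => k; apply: iI.2.
elim: k => [|k IHk]; first by rewrite mulr1.
by rewrite exprS mulrCA; apply: xI.
Qed.

(** Take [a] in [p] and a shortest product of primes inside [(a)]. Without its factor [p], the
    product is no longer inside [(a)]; for [b] in it outside [(a)], the element [b / a] maps [p]
    into [O] but is not in [O]. *)
Lemma prime_inv_nontrivial p : prime_ideal p -> exists2 g, ideal_inv p g & ~ O g.
Proof.
move=> pp; have [ip np _] := pp.
have /integralP [mp sp [a pa a0]] := ip.
have Oa := sp _ pa.
have [ps pps sps] := exists_prime_product (integral_principal a0 Oa).
(* Induction on the length takes the place of the choice of a shortest product. *)
have [n] := ubnP (size ps); elim: n ps pps sps => // n IHn ps pps sps sn.
have [_ _ pM] := mp.
have sap : principal_ideal a `<=` p by move=> _ [u Ou <-]; rewrite mulrC; apply: pM.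
have [_ [qs [pqs sqs e]]] := prime_above_product pp pps (subset_trans sps sap).
have [sqa|/existsNP [b /not_implyP [qb nab]]] :=
  pselect (ideal_prod qs `<=` principal_ideal a).
  by apply: (IHn qs) => //; apply: leq_trans sqs _.
exists (b / a); last first.
  by move=> Oba; apply: nab; exists (b / a) => //; rewrite mulrC mulfVK.
move=> x px; have : principal_ideal a (x * b).
  by apply: sps; rewrite e; apply: mem_ideal_mul.
by case=> u Ou eu; rewrite mulrAC mulrC -[b * x]mulrC -eu mulKf.
Qed.

Lemma inv_mul_sub I : ideal_mul I (ideal_inv I) `<=` O.
Proof.
apply: ideal_mul_sub; [exact: integers0|exact: integersD|].
by move=> x y Ix Hy; rewrite mulrC; apply: Hy.
Qed.

Lemma integral_inv1 I : integral_ideal I -> ideal_inv I 1.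
Proof. by move=> [_ sI] y Iy; rewrite mul1r; apply: sI. Qed.

Lemma mul_inv_integral I J : integral_ideal I -> integral_ideal J -> I `<=` J ->
  integral_ideal (ideal_mul I (ideal_inv J)) /\ I `<=` ideal_mul I (ideal_inv J).
Proof.
move=> iI iJ IJ; split; last first.
  by move=> x Ix; rewrite -[x]mulr1; apply: mem_ideal_mul => //; apply: integral_inv1.
split; last by apply: subset_trans (ideal_mulS IJ (@subset_refl _ _)) (@inv_mul_sub J).
by apply: fractional_mul; [case: iI|apply: fractional_inv; case: iJ].
Qed.

(** The ideal [p p^-1] lies between [p] and [O]. Were it [p], every element of [p^-1] would
    stabilize [p] and so be integral. *)
Lemma prime_invertible p : prime_ideal p -> ideal_mul p (ideal_inv p) = O.
Proof.
move=> pp; have [ip _ _] := pp.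
have [iq pq] := mul_inv_integral ip ip (@subset_refl _ p).
apply: (prime_maximal pp) => // e.
have [g Hg nOg] := prime_inv_nontrivial pp.
apply: nOg; apply: (ideal_stabilizer_integral ip) => y py.
by rewrite -e mulrC; apply: mem_ideal_mul.
Qed.

(** With [p] a prime above [I], the ideal [I p^-1] is strictly larger than [I], so it has an inverse
    [J] by induction, and [p^-1 J] inverts [I]. *)
Lemma integral_invertible I : integral_ideal I ->
  exists2 J, fractional_ideal J & ideal_mul I J = O.
Proof.
move: I; apply: noetherian_ind => I iI IHI.
have [->|nI] := pselect (I = O).
  by exists O; [case: integers_integral|rewrite ideal_mul1 //; apply: integers_submodule].
have [p pp Ip] := exists_prime_above iI nI; have [ip np _] := pp.
have [iq Iq] := mul_inv_integral iI ip Ip.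
have [|J fJ IJ] := IHI _ iq Iq.
  (* If [I p^-1 = I], then [p^-1] is inside [O], and [O = p p^-1] is inside [p]. *)
  move=> e; apply: np; apply/seteqP; split; first by case: ip.
  rewrite -[X in X `<=` _](prime_invertible pp) ideal_mulC.
  rewrite -[X in _ `<=` X]ideal_mul1; last exact: integral_submodule.
  apply: ideal_mulS => // g Hg; apply: (ideal_stabilizer_integral iI) => y Iy.
  by rewrite -e mulrC; apply: mem_ideal_mul.
exists (ideal_mul (ideal_inv p) J); last by rewrite ideal_mulA.
by apply: fractional_mul => //; apply: fractional_inv; case: ip.
Qed.

(** Clearing denominators gives an inverse [(a) J] of [I]; it is contained in [ideal_inv I], so [I]
    times [ideal_inv I] reaches [O]. *)
Lemma fractional_inv_mul I : fractional_ideal I -> ideal_mul I (ideal_inv I) = O.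
Proof.
move=> fI; have [I0 ID IM [x Ix x0] [a [Oa a0] aI]] := fI.
have mI := fractional_submodule fI.
have [|J fJ e] := @integral_invertible (ideal_mul (principal_ideal a) I).
  split; first by apply: fractional_mul => //; apply: fractional_principal.
  by rewrite ideal_mul_principal // => _ [y Iy <-]; apply: aI.
apply/seteqP; split; first exact: inv_mul_sub.
rewrite -[X in X `<=` _]e [ideal_mul _ I]ideal_mulC -ideal_mulA.
apply: ideal_mulS => // z Hz y Iy.
have : O (y * z) by rewrite -e [ideal_mul _ I]ideal_mulC -ideal_mulA; apply: mem_ideal_mul.
by rewrite mulrC.
Qed.

End IdealTheory.

(** * The group of fractional ideals and valuations *)

Section FracDef.
Variable K : fieldExtType rat.
Record fractional := FIdeal { fideal_set :> set K; fidealP : fractional_ideal fideal_set }.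
End FracDef.
Arguments FIdeal {K}.
Arguments fideal_set {K}.
Arguments fidealP {K}.

Section FracGroup.
Set Implicit Arguments.
Unset Strict Implicit.
Unset Printing Implicit Defensive.
Import GRing.Theory Num.Theory.
Local Open Scope ring_scope.
Local Open Scope classical_set_scope.
Variable K : fieldExtType rat.
Local Notation O := (@integers K).
Local Notation fideal := (fractional K).
Implicit Types A B C : fideal.

Lemma fideal_inj A B : fideal_set A = fideal_set B -> A = B.
Proof.
case: A => I fI; case: B => J fJ /= e; subst J.
by congr FIdeal; apply: Prop_irrelevance.
Qed.

Let mulf A B : fideal := FIdeal _ (fractional_mul (fidealP A) (fidealP B)).
Let onef : fideal := FIdeal _ (integers_integral K).1.
Let invf A : fideal := FIdeal _ (fractional_inv (fidealP A)).

Let mulfA : associative mulf.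
Proof. by move=> A B C; apply: fideal_inj; apply: ideal_mulA. Qed.
Let mulfC : commutative mulf.
Proof. by move=> A B; apply: fideal_inj; apply: ideal_mulC. Qed.
Let mul1f : left_id onef mulf.
Proof. by move=> A; apply: fideal_inj; apply/ideal_mul1/fractional_submodule/fidealP. Qed.
Let mulVf : left_inverse onef invf mulf.
Proof.
by move=> A; rewrite mulfC; apply: fideal_inj; apply/fractional_inv_mul/fidealP.
Qed.

(* The multiplicative group of fractional ideals is written additively, to use
   the theory of [zmodType]: [A + B] is the product, [- A] the inverse, [0] the
   ring of integers. *)
HB.instance Definition _ := gen_eqMixin fideal.
HB.instance Definition _ := gen_choiceMixin fideal.
HB.instance Definition _ := GRing.isZmodule.Build fideal mulfA mulfC mul1f mulVf.

Lemma fidealD A B : fideal_set (A + B) = ideal_mul A B. Proof. by []. Qed.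
Lemma fidealN A : fideal_set (- A) = ideal_inv A. Proof. by []. Qed.

Lemma fideal_exp A (n : int) : ideal_exp A n = A *~ n :> set K.
Proof.
have H (B : fideal) k : iter k (ideal_mul B) O = B *+ k :> set K.
  by elim: k => [|k IHk] //=; rewrite IHk mulrS.
case: n => k; first exact: H.
by rewrite NegzE mulrNz -mulNrz /ideal_exp -(H (- A) k.+1).
Qed.

Lemma fideal_submodule A : submodule A.
Proof. exact/fractional_submodule/fidealP. Qed.

Lemma fidealE (I : set K) : fractional_ideal I -> exists A : fideal, I = A.
Proof. by move=> fI; exists (FIdeal _ fI). Qed.

Lemma fideal_subD A A' B B' : A `<=` A' -> B `<=` B' -> A + B `<=` A' + B'.
Proof. exact: ideal_mulS. Qed.

Lemma fideal_subD2r C A B : A + C `<=` B + C <-> A `<=` B.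
Proof.
split=> [s|s]; last exact: fideal_subD.
by rewrite -(addrK C A) -(addrK C B); apply: fideal_subD.
Qed.

Lemma fideal_sub_integral A B : A `<=` B <-> integral_ideal (A - B).
Proof.
rewrite -(fideal_subD2r (- B)) subrr; split=> [s|[]//].
by split=> //; apply: fidealP.
Qed.

Lemma fideal_dvdP A B : ideal_dvd A B <-> B `<=` A.
Proof.
split=> [[L [fL sL] e]|].
  have [C eC] := fidealE fL; move: e sL; rewrite eC -fidealD => /fideal_inj -> sC.
  by rewrite -[X in _ `<=` fideal_set X]addr0; apply: fideal_subD.
move/fideal_sub_integral => i; exists (B - A) => //.
by rewrite -fidealD addrC subrK.
Qed.

(** * Principal ideals and valuations *)

Definition prin (a : K) (a0 : a != 0) : fideal := FIdeal _ (fractional_principal a0).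

Lemma prinE (a b : K) (a0 : a != 0) (b0 : b != 0) : a = b -> prin a0 = prin b0.
Proof. by move=> e; apply: fideal_inj; rewrite /= e. Qed.

Lemma prinM (a b : K) (a0 : a != 0) (b0 : b != 0) (ab0 : a * b != 0) :
  prin ab0 = prin a0 + prin b0.
Proof.
apply: fideal_inj; rewrite fidealD ideal_mul_principal; last exact: principal_submodule.
apply/seteqP; split.
  by move=> _ [u Ou <-]; exists (b * u); rewrite ?mulrA //; exists u.
by move=> _ [_ [u Ou <-] <-]; exists u; rewrite ?mulrA.
Qed.

Lemma prin1 (n0 : (1 : K) != 0) : prin n0 = 0.
Proof.
apply: fideal_inj; apply/seteqP; split=> [_ [u Ou <-]|u Ou]; first by rewrite mul1r.
by exists u; rewrite ?mul1r.
Qed.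

Lemma prin_sub (a : K) (a0 : a != 0) A : prin a0 `<=` A <-> fideal_set A a.
Proof.
split=> [s|Aa _ [u Ou <-]]; first exact/s/mem_principal.
by have [_ _ AM] := fideal_submodule A; rewrite mulrC; apply: AM.
Qed.

Lemma fideal_nonzero A : exists2 a, fideal_set A a & a != 0.
Proof. by case: (fidealP A). Qed.

Lemma prin_inv (a : K) (a0 : a != 0) (b0 : a^-1 != 0) : prin b0 = - prin a0.
Proof.
have ab0 : a * a^-1 != 0 by rewrite divff // oner_neq0.
apply/eqP; rewrite -addr_eq0 addrC -(prinM a0 b0 ab0).
by apply/eqP; rewrite -(prin1 (oner_neq0 K)); apply: prinE; rewrite divff.
Qed.

Lemma fideal_integral A : integral_ideal A <-> A `<=` O.
Proof. by split=> [[]//|s]; split=> //; apply: fidealP. Qed.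

Lemma fideal_quotient A : exists B C, [/\ B `<=` O, C `<=` O & A = B - C].
Proof.
have [A0 AD AM _ [a [Oa a0] sA]] := fidealP A.
exists (prin a0 + A), (prin a0); split.
- by rewrite fidealD ideal_mul_principal // => _ [x Ax <-]; apply: sA.
- exact/(prin_sub a0 0).
- by rewrite addrC addKr.
Qed.

Lemma prime_sub p A B : prime_ideal p -> A `<=` O -> B `<=` O -> A + B `<=` p ->
  A `<=` p \/ B `<=` p.
Proof. exact: prime_mul_sub. Qed.

Lemma integral_subD A B : B `<=` O -> A + B `<=` A.
Proof. by move=> sB; rewrite -[X in _ `<=` fideal_set X]addr0; apply: fideal_subD. Qed.

(** Noetherian induction: an ideal inside [p] is divided by [p], which strictly enlarges it. *)
Lemma prime_val_integral (p A : fideal) : prime_ideal p -> A `<=` O ->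
  exists (n : nat) B, [/\ B `<=` O, ~ B `<=` p & A = p *+ n + B].
Proof.
move=> pp /fideal_integral iA; have [ip np _] := pp.
suff H : forall I, integral_ideal I -> forall A, I = A ->
    exists (n : nat) B, [/\ B `<=` O, ~ B `<=` p & A = p *+ n + B].
  exact: (H A).
apply: noetherian_ind => I iI IHI {iA}A eIA.
have [Ap|nAp] := pselect (A `<=` p); last first.
  by exists 0%N, A; split; rewrite ?add0r // -eIA; case: iI.
have [||//|n [B [sB nB e]]] := IHI (A - p) _ _ _ _ (erefl _).
- exact/fideal_sub_integral.
- rewrite eIA; have : A + 0 `<=` A - p; last by rewrite addr0.
  apply: fideal_subD => //.
  rewrite -(fideal_subD2r p) add0r addNr; by case: ip.
- rewrite eIA -[X in _ <> fideal_set X]addr0 => /fideal_inj /addrI /eqP.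
  by rewrite oppr_eq0 => /eqP p0; apply: np; rewrite p0.
by exists n.+1, B; split=> //; rewrite mulrS -addrA -e addrC subrK.
Qed.

(** The relation [A = p^n B / C] with [p] dividing neither [B] nor [C]; the denominator is
    multiplied out to ease comparison of two such relations. *)
Definition has_val (p : fideal) (n : int) A : Prop :=
  exists B C, [/\ B `<=` O, C `<=` O, ~ B `<=` p, ~ C `<=` p & A + C = p *~ n + B].

Lemma has_val_exists (p A : fideal) : prime_ideal p -> exists n, has_val p n A.
Proof.
move=> pp; have [B [C [sB sC ->]]] := fideal_quotient A.
have [n [B' [sB' nB' ->]]] := prime_val_integral pp sB.
have [k [C' [sC' nC' ->]]] := prime_val_integral pp sC.
exists (n%:Z - k%:Z), B', C'; split=> //.
by rewrite mulrzBr -!pmulrn opprD !addrA subrK addrAC.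
Qed.

Lemma integral_addf A B : A `<=` O -> B `<=` O -> A + B `<=` O.
Proof. by move=> sA; apply: subset_trans; rewrite addrC; apply: integral_subD. Qed.

Lemma integral_mulrn A n : A `<=` O -> A *+ n `<=` O.
Proof.
by move=> sA; elim: n => [|n IHn] //; rewrite mulrS; apply: integral_addf.
Qed.

Lemma lez_addn (n k : int) : (n <= k)%R -> exists j : nat, k = n + j.
Proof.
rewrite -subr_ge0 => lek; exists `|k - n|%N.
by rewrite (gez0_abs lek) addrC subrK.
Qed.

Lemma ltz_addnS (n k : int) : (n < k)%R -> exists j : nat, k = n + j.+1.
Proof.
rewrite -lezD1 => /lez_addn [j ->]; exists j.
by rewrite -addrA -[j.+1]addn1 PoszD [_ + 1]addrC.
Qed.

(** If [n < k], cancelling [p^n] between the two relations puts [B C'] inside [p], against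
    primality. *)
Lemma has_val_uniq (p A : fideal) (n k : int) :
  prime_ideal p -> has_val p n A -> has_val p k A -> n = k.
Proof.
move=> pp; wlog lt : n k / (n < k)%R.
  move=> W; case: (Order.TotalTheory.ltgtP n k) => // lt H H'; first exact: W H H'.
  by apply/esym; apply: W H' H.
move=> [B [C [sB sC nB nC e]]] [B' [C' [sB' sC' nB' nC' e']]].
have [ip np _] := pp.
have sp : p `<=` O by case: ip.
have [j Dk] := ltz_addnS lt.
have e2 : B + C' = p *+ j.+1 + B' + C.
  apply: (addrI (p *~ n)); rewrite addrA -e addrAC e' Dk mulrzDr.
  by rewrite -pmulrn !addrA.
have : B + C' `<=` p.
  rewrite e2 mulrS -!addrA; apply: integral_subD.
  by do 2?apply: integral_addf => //; apply: integral_mulrn.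
by move/(prime_sub pp) => [].
Qed.

(** Since a valuation exists, [xget] returns one rather than its default. *)
Lemma ideal_valP (p A : fideal) : prime_ideal p -> has_val p (ideal_val p A) A.
Proof.
move=> pp; have G n : has_val p n A <-> exists I J : set K,
    [/\ integral_ideal I, integral_ideal J, ~ ideal_dvd p I, ~ ideal_dvd p J &
        (A : set K) = ideal_mul (ideal_exp p n) (ideal_div I J)].
  split=> [[B [C [sB sC nB nC e]]]|[I [J [iI iJ nI nJ e]]]].
    exists B, C; split; rewrite ?fideal_dvdP //; [exact/fideal_integral..|].
    by rewrite fideal_exp /ideal_div -fidealN -!fidealD addrA -e addrK.
  have [B eB] := fidealE iI.1; have [C eC] := fidealE iJ.1; subst I J.
  exists B, C; split; rewrite -?fideal_dvdP //; [by case: iI|by case: iJ|].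
  move: e; rewrite fideal_exp /ideal_div -fidealN -!fidealD => /fideal_inj ->.
  by rewrite addrA subrK.
have [n Hn] := has_val_exists A pp.
have -> : ideal_val p A = xget 0 [set n | has_val p n A].
  by congr xget; apply/seteqP; split=> k /G.
by apply: (xgetPex 0 (P := [set n | has_val p n A])); exists n.
Qed.

Lemma ideal_val_eq (p A : fideal) n : prime_ideal p -> has_val p n A -> ideal_val p A = n.
Proof. by move=> pp H; apply: (has_val_uniq pp (ideal_valP A pp) H). Qed.

End FracGroup.

(** * Coprimality and congruences without valuations *)

Section Coprime.
Set Implicit Arguments.
Unset Strict Implicit.
Unset Printing Implicit Defensive.
Import GRing.Theory Num.Theory.
Local Open Scope ring_scope.
Local Open Scope classical_set_scope.
Variable K : fieldExtType rat.
Local Notation O := (@integers K).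
Local Notation fideal := (fractional K).
Implicit Types (A B C m b : fideal) (p : set K) (x y a : K).

Lemma prime_fideal p : prime_ideal p -> exists q : fideal, p = q.
Proof. by case=> [[/fidealE]]. Qed.

Lemma prime_not1 p : prime_ideal p -> ~ p 1.
Proof.
move=> [ip np _] p1; apply: np; apply: submodule_eq1 ip.2 p1.
exact: integral_submodule.
Qed.

Lemma coprime_idealsP A B : A `<=` O -> B `<=` O ->
  coprime_ideals A B <-> (forall p, prime_ideal p -> A `<=` p -> ~ B `<=` p).
Proof.
move=> sA sB; split=> [e p pp Ap Bp|H].
  have [ip np _] := pp; apply: np; apply/seteqP; split; first by case: ip.
  by rewrite -e; apply: ideal_add_sub Ap Bp; apply: integral_submodule.
apply: contrapT => nO.
have [|p pp sp] := exists_prime_above _ nO.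
  by apply: integral_add_ideal => //; [apply/fideal_integral|apply: fideal_submodule].
apply: (H p pp); apply: subset_trans sp.
  exact/ideal_add_subl/fideal_submodule.
exact/ideal_add_subr/fideal_submodule.
Qed.

Lemma coprimeC A B : coprime_ideals A B -> coprime_ideals B A.
Proof.
rewrite /coprime_ideals => <-; apply/seteqP.
by split=> _ [x Ax [y By <-]]; exists y => //; exists x; rewrite // addrC.
Qed.

Lemma coprimeD A B C : A `<=` O -> B `<=` O -> C `<=` O ->
  coprime_ideals A C -> coprime_ideals B C -> coprime_ideals (A + B : fideal) C.
Proof.
move=> sA sB sC /(coprime_idealsP sA sC) cA /(coprime_idealsP sB sC) cB.
apply/coprime_idealsP => //; first by apply: subset_trans sA; apply: integral_subD.
move=> p pp /(prime_sub pp sA sB) [Ap|Bp]; [exact: cA|exact: cB].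
Qed.

Lemma coprimeS A B C : A `<=` O -> B `<=` C -> C `<=` O ->
  coprime_ideals A B -> coprime_ideals A C.
Proof.
move=> sA BC sC cAB; have sB := subset_trans BC sC.
apply/coprime_idealsP => // p pp Ap Cp.
have /(coprime_idealsP sA sB) H := cAB.
by apply: (H p pp Ap); apply: subset_trans Cp.
Qed.

Lemma coprime_mem A B : coprime_ideals A B ->
  exists2 x, fideal_set A x & fideal_set B (x - 1).
Proof.
move/seteqP => [_ /(_ 1 (integers1 K))] [x Ax [y By <-]]; exists x => //.
rewrite opprD addNKr -mulN1r; have [_ _ BM] := fideal_submodule B.
by apply: BM => //; apply/integersN/integers1.
Qed.

Lemma coprime_prin m x (x0 : x != 0) : m `<=` O -> fideal_set m (x - 1) ->
  O x /\ coprime_ideals (prin x0) m.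
Proof.
move=> sm mx; have Ox : O x.
  by rewrite -(subrK 1 x); apply: integersD; [apply: sm|apply: integers1].
split=> //; have sx : prin x0 `<=` O by apply/(prin_sub _ 0).
apply/coprime_idealsP => // p pp xp mp; apply: (prime_not1 pp).
have [ip _ _] := pp; rewrite -(subKr x 1).
apply: submoduleB; first exact: integral_submodule.
  exact/xp/mem_principal.
exact: mp.
Qed.

Lemma dvd_prime p m : prime_ideal p -> ideal_dvd p m <-> m `<=` p.
Proof. by move=> /prime_fideal [q ->]; apply: fideal_dvdP. Qed.

(** Valuations are traded for coprimality. For the direct implication, [C] is the ideal of all
    integers that multiply [A] into [O]. *)
Lemma prime_toP m A : m `<=` O -> prime_to m A <->
  exists B C, [/\ B `<=` O, C `<=` O, coprime_ideals B m, coprime_ideals C m & A = B - C].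
Proof.
move=> sm; split=> [Am|[B [C [sB sC cB cC ->]]] p pp /(dvd_prime _ pp) mp]; last first.
  have [q eq] := prime_fideal pp; subst p; apply: ideal_val_eq => //.
  have /(coprime_idealsP sB sm) HB := cB; have /(coprime_idealsP sC sm) HC := cC.
  exists B, C; split=> //; [by move/(HB _ pp); apply|by move/(HC _ pp); apply|].
  by rewrite subrK add0r.
have [A0 AD AM _ [d [Od d0] sA]] := fidealP A.
pose I := [set x | O x /\ ideal_inv A x].
have iI : integral_ideal I.
  have [V0 VD VM] := ideal_inv_submodule A.
  have [O0 OD OM] := integers_submodule K.
  apply/integralP; split; last by exists d.
    split=> //; first by move=> x y [Ox Vx] [Oy Vy]; split; [apply: OD|apply: VD].
    by move=> a x Oa [Ox Vx]; split; [apply: OM|apply: VM].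
  by move=> x [].
have [C eC] := fidealE iI.1.
have sC : C `<=` O by rewrite -eC => x [].
(* Valuation 0 gives [A C' = B'] with neither [B'] nor [C'] inside [p]. As [C'] is inside [C] and
   [B'] inside [A C], the prime contains neither [C] nor [A C]. *)
have G p : prime_ideal p -> m `<=` p -> ~ C `<=` p /\ ~ A + C `<=` p.
  move=> pp mp; have [q eq] := prime_fideal pp; subst p.
  have := ideal_valP A pp; rewrite Am //; last exact/dvd_prime.
  move=> [B' [C' [sB' sC' nB' nC']]]; rewrite add0r => e.
  have C'C : C' `<=` C.
    rewrite -eC => x C'x; split; first exact: sC'.
    by move=> y Ay; apply: sB'; rewrite -e fidealD mulrC; apply: mem_ideal_mul.
  split=> s; first by apply: nC'; apply: subset_trans s.
  by apply: nB'; apply: subset_trans s; rewrite -e; apply: fideal_subD.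
have sAC : A + C `<=` O.
  have : A + C `<=` A - A; last by rewrite subrr.
  by apply: fideal_subD => //; rewrite -eC => x [].
exists (A + C), C; split; rewrite ?addrK //; apply/coprime_idealsP => // p pp s /(G p pp) [] //.
Qed.

(** The conditions at the primes above [m] become a single quotient of elements congruent to 1, a
    form visibly stable under products and inverses. *)
Lemma cong1P m a : m `<=` O -> cong1 m a <->
  exists x y, [/\ fideal_set m (x - 1), fideal_set m (y - 1), y != 0 & a = x / y].
Proof.
move=> sm; have mm := fideal_submodule m; have [m0 mD mM] := mm; split; last first.
  move=> [x [y [mx my y0 ea]]].
  have [->|a1] := eqVneq a 1; first by left.
  right=> p pp /(dvd_prime _ pp) mp; have [q eq] := prime_fideal pp; subst p.
  have a10 : a - 1 != 0 by rewrite subr_eq0.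
  have ya0 : y * (a - 1) != 0 by rewrite mulf_neq0.
  have sYa : prin y0 + prin a10 `<=` m.
    rewrite -(prinM _ _ ya0); apply/prin_sub.
    have -> : y * (a - 1) = (x - 1) - (y - 1) by rewrite ea; field.
    exact: submoduleB.
  have [Oy cy] := coprime_prin y0 sm my.
  have sy : prin y0 `<=` O by apply/(prin_sub _ 0).
  have [A [B [sA sB nA nB eAB]]] := ideal_valP m pp.
  have := ideal_valP (prin a10) pp; rewrite -[fideal_set (prin a10)]/(principal_ideal (a - 1)).
  move: (ideal_val q m) (ideal_val q (principal_ideal (a - 1))) eAB.
  move=> u v eAB [A' [B' [sA' sB' nA' nB' eAB']]].
  (* If the valuation [v] of [a - 1] were below the valuation [u] of [m], cancelling [q^v] would put
     [(y) A' B] inside [q], although no factor is. *)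
  rewrite Order.TotalTheory.leNgt; apply/negP => ltvu.
  have [j Dk] := ltz_addnS ltvu.
  have : prin y0 + A' + B `<=` q.
    have : prin y0 + A' + B `<=` q *+ j.+1 + (A + B').
      rewrite -(fideal_subD2r (q *~ v)).
      have -> : prin y0 + A' + B + q *~ v = prin y0 + prin a10 + B + B'.
        rewrite [RHS](ACl (1*(2*4)*3))%AC /= eAB'.
        by rewrite [LHS](ACl (1*(4*2)*3))%AC.
      have -> : q *+ j.+1 + (A + B') + q *~ v = m + B + B'.
        by rewrite eAB Dk mulrzDr -pmulrn [LHS]addrC !addrA.
      by do 2!(apply: fideal_subD => //).
    move=> s; apply: subset_trans s _; rewrite mulrS -addrA; apply: integral_subD.
    by do 2?apply: integral_addf => //; apply: integral_mulrn; case: pp => -[].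
  move/(prime_sub pp) => [|//|/(prime_sub pp) [//|//||//]|//]; first exact: integral_addf.
  move=> s; have /(coprime_idealsP sy sm) H := cy; exact: (H _ pp s).
have [a1|na1] := eqVneq a 1 => [_|].
  by exists 1, 1; rewrite subrr a1 divr1 oner_neq0.
move=> [/eqP|v_le]; first by rewrite (negPf na1).
have a10 : a - 1 != 0 by rewrite subr_eq0.
(* [D] collects the integers multiplying [a - 1] into [m]. It is coprime to [m], so it provides a
   denominator [y] congruent to 1. *)
pose D := [set x | O x /\ fideal_set m (x * (a - 1))].
have [O0 OD OM] := integers_submodule K.
have iD : integral_ideal D.
  apply/integralP; split; first split.
  - by split=> //; rewrite mul0r.
  - by move=> x y [Ox mx] [Oy my]; split; [apply: OD|rewrite mulrDl; apply: mD].
  - by move=> c x Oc [Ox mx]; split; [apply: OM|rewrite -mulrA; apply: mM].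
  - by move=> x [].
  have [N N0 ON] := integers_denominator (a - 1); have [c mc c0] := fideal_nonzero m.
  exists (c * N%:R); last by rewrite mulf_neq0 // natr_fieldExt_eq0 -lt0n.
  split; first by apply: OM; [apply: sm|apply: integers_nat].
  by rewrite -mulrA mulrC; apply: mM.
have [D' eD] := fidealE iD.1.
have sD : D' `<=` O by rewrite -eD => x [].
have cD : coprime_ideals D' m.
  apply/coprime_idealsP => // p pp Dp mp; have [q eq] := prime_fideal pp; subst p.
  have := v_le q pp; rewrite dvd_prime // => /(_ mp).
  have [A [B [sA sB nA nB eAB]]] := ideal_valP m pp.
  have := ideal_valP (prin a10) pp; rewrite -[fideal_set (prin a10)]/(principal_ideal (a - 1)).
  move: (ideal_val q m) (ideal_val q (principal_ideal (a - 1))) eAB.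
  move=> u v eAB [A' [B' [sA' sB' nA' nB' eAB']]] leuv.
  have [j Dk] := lez_addn leuv.
  (* With [v = u + j], the product of [A B'] and [(a - 1)] is [m B q^j A'], inside [m]. *)
  have : A + B' `<=` D'.
    rewrite -eD => x ABx; split; first by apply: (integral_addf sA sB').
    have : A + B' + prin a10 `<=` m.
      have -> : A + B' + prin a10 = m + (B + (q *+ j + A')).
        rewrite !addrA eAB [LHS]addrAC -[LHS]addrA eAB' Dk mulrzDr -pmulrn.
        by rewrite !addrA [A + _]addrC.
      apply: integral_subD; do 2!apply: integral_addf => //.
      by apply: integral_mulrn; case: pp => -[].
    by apply; apply: mem_ideal_mul => //; apply: mem_principal.
  by move=> s; have /(prime_sub pp) [] := subset_trans s Dp.
have [d Dd md] := coprime_mem cD.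
have [y [Dy my y0]] : exists y, [/\ D y, fideal_set m (y - 1) & y != 0].
  (* The denominator must be non-zero. If [d] is 0, then 1 is in [m], every integer is congruent to
     1, and any non-zero element of [D] serves. *)
  have [d0|d0] := eqVneq d 0; last by exists d; rewrite eD.
  have m1 : fideal_set m 1.
    move: md; rewrite d0 sub0r => /(mM (-1) _ _); rewrite mulrNN mulr1; apply.
    exact/integersN/integers1.
  have [_ _ [y Dy y0]] : [/\ submodule D, D `<=` O & exists2 x, D x & x != 0].
    exact/integralP.
  exists y; split=> //; rewrite -[y - 1]mulr1; apply: mM => //.
  by case: Dy => Oy _; apply: integersB => //; apply: integers1.
exists (a * y), y; split=> //; last by rewrite mulfK.
have -> : a * y - 1 = y * (a - 1) + (y - 1) by ring.
by apply: mD => //; case: Dy.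
Qed.

End Coprime.

(** * Integral representatives of ray classes *)

Section RayClasses.
Set Implicit Arguments.
Unset Strict Implicit.
Unset Printing Implicit Defensive.
Import GRing.Theory Num.Theory.
Local Open Scope ring_scope.
Local Open Scope classical_set_scope.
Variable K : fieldExtType rat.
Local Notation O := (@integers K).
Local Notation fideal := (fractional K).
Variable m : fideal.
Hypothesis sm : m `<=` O.
Implicit Types (A B C b : fideal) (p : set K) (x y a : K).

Lemma exists_not_sub A B : ~ A `<=` B -> exists2 x, fideal_set A x & ~ fideal_set B x.
Proof. by move=> /existsNP [x /not_implyP [Ax nBx]]; exists x. Qed.

Lemma ideal_prod_sub ps p : primes_seq ps -> p \in ps -> ideal_prod ps `<=` p.
Proof.
elim: ps => // r ps IHps pps; have pr : prime_ideal r by apply: pps; rewrite mem_head.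
have pps' : primes_seq ps by move=> s sps; apply: pps; rewrite inE sps orbT.
have [ir _ _] := pr; have [_ si] := ideal_prod_integral pps'.
rewrite inE /= => /predU1P [->|/(IHps pps') s].
  rewrite ideal_mulC -[X in _ `<=` X](ideal_mul1 (integral_submodule ir)).
  exact: ideal_mulS.
apply: subset_trans s; rewrite -[X in _ `<=` X]ideal_mul1; last first.
  exact/integral_submodule/ideal_prod_integral.
by apply: ideal_mulS => //; case: ir.
Qed.

(* If [x] fails at the next prime [q], add an element of [A m] times the previous
   primes that is not in [q A]: the other conditions are preserved. *)
Lemma prime_avoidance A ps : A `<=` O -> coprime_ideals A m -> primes_seq ps ->
  exists x, [/\ fideal_set A x, fideal_set m (x - 1), x != 0 &
    forall q : fideal, fideal_set q \in ps -> ~ fideal_set (q + A) x].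
Proof.
move=> sA cA; have [A0 AD AM] := fideal_submodule A; have [m0 mD mM] := fideal_submodule m.
elim: ps => [|p ps IHps] pps.
  have [x Ax mx] := coprime_mem cA.
  have [x0|x0] := eqVneq x 0; last by exists x.
  have m1 : fideal_set m 1.
    move: mx; rewrite x0 sub0r => /(mM (-1) _ _); rewrite mulrNN mulr1; apply.
    exact/integersN/integers1.
  have [y Ay y0] := fideal_nonzero A; exists y; split=> //.
  rewrite -[y - 1]mulr1; apply: mM => //; apply: integersB; first exact: sA.
  exact: integers1.
have pp : prime_ideal p by apply: pps; rewrite mem_head.
have [q eq] := prime_fideal pp; subst p.
have pps' : primes_seq ps by move=> r rps; apply: pps; rewrite inE rps orbT.
have [x [Ax mx x0 nx]] := IHps pps'.
have [qx|nqx] := pselect (fideal_set (q + A) x); last first.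
  exists x; split=> // r; rewrite inE => /predU1P [/fideal_inj ->//|]; exact: nx.
have nqps : ~ (fideal_set q \in ps) by move/nx.
have qAq : q + A `<=` q by apply: integral_subD.
have nmq : ~ m `<=` q.
  move=> mq; apply: (prime_not1 pp); rewrite -(subKr x 1).
  apply: submoduleB; [exact: fideal_submodule|exact: qAq|exact: mq].
have [P eP] := fidealE (ideal_prod_integral pps').1.
have sP : P `<=` O by rewrite -eP; case: (ideal_prod_integral pps').
(* [q] does not contain [P], not being among the earlier primes, nor [m], since it contains [x]
   congruent to 1. Multiplying by [A] then yields the correction [y]. *)
have nPm : ~ P + m `<=` q.
  move/(prime_sub pp sP sm) => [|//]; rewrite -eP => s.
  by have [] := prime_above_product pp pps' s.
have [y PmAy nqAy] : exists2 y, fideal_set (P + m + A) y & ~ fideal_set (q + A) y.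
  by apply: exists_not_sub; rewrite fideal_subD2r.
have my : fideal_set m y.
  suff : P + m + A `<=` m by apply.
  have -> : P + m + A = m + (P + A) by rewrite addrA [m + P]addrC.
  by apply: integral_subD; apply: integral_addf.
have Ay : fideal_set A y.
  suff : P + m + A `<=` A by apply.
  by rewrite addrC; apply: integral_subD; apply: integral_addf.
have nqxy : ~ fideal_set (q + A) (x + y).
  move=> qxy; apply: nqAy; rewrite -[y](addKr x) [- x + _]addrC.
  by apply: submoduleB => //; apply: fideal_submodule.
exists (x + y); split; first exact: AD.
- by rewrite addrAC; apply: mD.
- by apply/eqP => xy0; apply: nqxy; rewrite xy0; case: (fideal_submodule (q + A)).
move=> r; rewrite inE => /predU1P [/fideal_inj ->//|rps] rxy; apply: (nx r rps).
rewrite -[x](addrK y); apply: submoduleB => //; first exact: fideal_submodule.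
have : P + m + A `<=` r + A.
  apply: fideal_subD => //; apply: subset_trans (integral_subD sm) _.
  by rewrite -eP; apply: ideal_prod_sub.
exact.
Qed.

(** A prime [q] divides [(x) / A] only if [x] is in [q A]. It suffices to avoid [q A] for the
    factors [q] of a product of primes inside [b], which include every prime above [b]. *)
Lemma inverse_coprime_rep A b : A `<=` O -> b `<=` O -> coprime_ideals A m ->
  exists x (x0 : x != 0), [/\ fideal_set m (x - 1), prin x0 - A `<=` O &
    coprime_ideals (prin x0 - A : fideal) b].
Proof.
move=> sA sb cA; have [ps pps sps] := exists_prime_product (proj2 (fideal_integral b) sb).
have [x [Ax mx x0 nx]] := prime_avoidance sA cA pps; exists x, x0.
have sx : prin x0 - A `<=` O.
  by apply/fideal_integral/fideal_sub_integral/prin_sub.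
split=> //; apply/coprime_idealsP => // p pp; have [q eq] := prime_fideal pp; subst p => xq bq.
have [qps _] := prime_above_product pp pps (subset_trans sps bq).
apply: (nx q qps); apply/(prin_sub x0).
by rewrite -(subrK A (prin x0)); apply: fideal_subD.
Qed.

Definition ray A : Prop := exists x (x0 : x != 0), cong1 m x /\ A = prin x0.

Lemma cong1_ray x (x0 : x != 0) : fideal_set m (x - 1) -> ray (prin x0).
Proof.
move=> mx; exists x, x0; split=> //; apply/(cong1P _ sm); exists x, 1.
by rewrite divr1 subrr oner_neq0; split=> //; case: (fideal_submodule m).
Qed.

Lemma ray0 : ray 0.
Proof.
rewrite -(prin1 (oner_neq0 K)); apply: cong1_ray.
by rewrite subrr; case: (fideal_submodule m).
Qed.

Lemma congM x y : fideal_set m (x - 1) -> fideal_set m (y - 1) -> fideal_set m (x * y - 1).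
Proof.
move=> mx my; have [_ mD mM] := fideal_submodule m.
have Ox : O x.
  by rewrite -(subrK 1 x); apply: integersD; [apply: sm|apply: integers1].
have -> : x * y - 1 = x * (y - 1) + (x - 1) by ring.
by apply: mD => //; apply: mM.
Qed.

Lemma rayN A : ray A -> ray (- A).
Proof.
move=> [a [a0 [/(cong1P _ sm) [x [y [mx my y0 e]]] ->]]].
have V0 : a^-1 != 0 by rewrite invr_eq0.
exists a^-1, V0; rewrite (prin_inv a0 V0); split=> //; apply/(cong1P _ sm).
exists y, x; split=> //; last by rewrite e invf_div.
by apply: contraNneq a0 => x0; rewrite e x0 mul0r.
Qed.

Lemma rayD A B : ray A -> ray B -> ray (A + B).
Proof.
move=> [a [a0 [/(cong1P _ sm) [x [y [mx my y0 ea]]] ->]]].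
move=> [b [b0 [/(cong1P _ sm) [z [t [mz mt t0 eb]]] ->]]].
have ab0 : a * b != 0 by rewrite mulf_neq0.
exists (a * b), ab0; rewrite (prinM a0 b0 ab0); split=> //; apply/(cong1P _ sm).
exists (x * z), (y * t); split; [exact: congM|exact: congM|exact: mulf_neq0|].
by rewrite ea eb mulf_div.
Qed.

Lemma prime_toD A B : prime_to m A -> prime_to m B -> prime_to m (A + B : fideal).
Proof.
move=> /(prime_toP _ sm) [C [D [sC sD cC cD ->]]].
move=> /(prime_toP _ sm) [C' [D' [sC' sD' cC' cD' ->]]].
apply/(prime_toP _ sm); exists (C + C'), (D + D').
by split; [exact: integral_addf..|exact: coprimeD|exact: coprimeD|rewrite opprD addrACA].
Qed.

Lemma prime_toN A : prime_to m A -> prime_to m (- A : fideal).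
Proof.
move=> /(prime_toP _ sm) [C [D [sC sD cC cD ->]]].
by apply/(prime_toP _ sm); exists D, C; rewrite opprB.
Qed.

Lemma ray_prime_to A : ray A -> prime_to m A.
Proof.
move=> [a [a0 [/(cong1P _ sm) [x [y [mx my y0 e]]] ->]]].
have x0 : x != 0 by apply: contraNneq a0 => x0; rewrite e x0 mul0r.
have V0 : y^-1 != 0 by rewrite invr_eq0.
have xV0 : x * y^-1 != 0 by rewrite mulf_neq0.
have -> : prin a0 = prin x0 - prin y0.
  by rewrite -(prin_inv y0 V0) -(prinM x0 V0 xV0); apply: prinE.
have [Ox cx] := coprime_prin x0 sm mx; have [Oy cy] := coprime_prin y0 sm my.
apply/(prime_toP _ sm); exists (prin x0), (prin y0); split=> //.
  exact/(prin_sub _ 0).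
exact/(prin_sub _ 0).
Qed.

(** With [A = B / C], [inverse_coprime_rep] represents inverse classes, so it is applied once to [C]
    and twice in a row for [B]. The intermediate ideal [(y) / B] is made coprime to [m] to allow the
    second application. *)
Lemma integral_coprime_rep A b : b `<=` O -> prime_to m A ->
  exists E : fideal, [/\ E `<=` O, coprime_ideals E b & ray (E - A)].
Proof.
move=> sb /(prime_toP _ sm) [B [C [sB sC cB cC ->]]].
have [x [x0 [mx sx cx]]] := inverse_coprime_rep sC sb cC.
have [y [y0 [my sy cy]]] := inverse_coprime_rep sB sm cB.
have [z [z0 [mz sz cz]]] := inverse_coprime_rep sy sb cy.
exists (prin x0 - C + (prin z0 - (prin y0 - B))); split.
- exact: integral_addf.
- exact: coprimeD.
have -> : prin x0 - C + (prin z0 - (prin y0 - B)) - (B - C) = prin x0 + (prin z0 - prin y0).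
  by rewrite !opprB !addrA [LHS](ACl (1*3*5*(2*6)*(4*7)))%AC /= addNr subrr !addr0.
by apply: rayD; [|apply: rayD; [|apply: rayN]]; apply: cong1_ray.
Qed.

End RayClasses.

(** * Ordinals and the Euclidean descent *)

Section Ordinals.
Set Implicit Arguments.
Unset Strict Implicit.
Unset Printing Implicit Defensive.
Local Open Scope classical_set_scope.

Section WellOrder.
Variables (T : Type) (le : rel T).
Hypothesis wo : well_order le.

Lemma wo_min (P : set T) : P !=set0 -> exists2 z, P z & forall x, P x -> le z x.
Proof.
move=> [x Px]; have [|z [[Pz zP] _]] := wo (A := fun x => `[< P x >]).
  by exists x; apply/asboolP.
by exists z => [|y Py]; [apply/asboolP|apply: zP; apply/asboolP].
Qed.

Lemma wo_refl z : le z z.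
Proof. by have [|_ -> H] := @wo_min [set z]; [exists z|apply: H]. Qed.

(** Both elements are minima of the pair, and [well_order] makes minima unique. *)
Lemma wo_anti x y : le x y -> le y x -> x = y.
Proof.
move=> xy yx; have rx := wo_refl x; have ry := wo_refl y.
pose P := [set z | z = x \/ z = y].
have [|z [_ zu]] := wo (A := fun z => `[< P z >]).
  by exists x; apply/asboolP; left.
have -> : x = z.
  by apply/esym/zu; split=> [|w /asboolP [->|->]] //; apply/asboolP; left.
by apply/zu; split=> [|w /asboolP [->|->]] //; apply/asboolP; right.
Qed.

Lemma wo_trans x y z : le x y -> le y z -> le x z.
Proof.
move=> xy yz.
have [|w Pw Hw] := @wo_min [set w | [\/ w = x, w = y | w = z]].
  by exists x; constructor 1.
have wx : le w x by apply: Hw; constructor 1.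
have wy : le w y by apply: Hw; constructor 2.
have wz : le w z by apply: Hw; constructor 3.
case: Pw => e; subst w => //; first by rewrite -(wo_anti wx xy).
by rewrite -(wo_anti yz wy).
Qed.

Lemma wo_wf : well_founded (fun x y => le x y /\ x <> y).
Proof.
move=> x; apply: contrapT => nx.
have [|z nz zmin] := @wo_min [set x | ~ Acc (fun x y => le x y /\ x <> y) x].
  by exists x.
apply: nz; constructor=> y [yz nyz]; apply: contrapT => ny.
by apply: nyz; apply: wo_anti (zmin _ ny).
Qed.

End WellOrder.

(** Everything below [v] is isomorphic to a proper initial segment of [v], so descent among
    well-orders becomes descent among elements of [v]. *)
Lemma on_lt_wf : well_founded on_lt.
Proof.
suff H v (b : on_sort v) : forall u,
    (exists f : on_sort u -> on_sort v,
      (forall x y, on_le x y <-> on_le (f x) (f y)) /\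
      range f = [set z | on_le z b /\ z <> b]) -> Acc on_lt u.
  by move=> v; constructor=> u [b Hf]; apply: (H v b).
elim: {b}(b : on_sort v) / (wo_wf (on_wo (o := v)) b) => b _ IHb u [f [fle fr]].
constructor=> w [c [g [gle gr]]].
have finj x y : f x = f y -> x = y.
  move=> e; apply: (wo_anti (on_wo (o := u))); apply/fle; rewrite e; exact/wo_refl/on_wo.
have [fcb nfcb] : on_le (f c) b /\ f c <> b.
  by have : range f (f c) by []; rewrite fr.
apply: (IHb (f c)); first by split.
(* [g] identifies [w] with the segment of [u] below [c]; composed with [f], it identifies [w] with
   the segment of [v] below [f c], and [f c] is below [b]. *)
exists (f \o g); split=> [x y|]; first by rewrite gle fle.
apply/seteqP; split=> [_ [x _ <-]|z [zfc nzfc]] /=.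
  have [gc ngc] : on_le (g x) c /\ g x <> c by have : range g (g x) by []; rewrite gr.
  by split; [apply/fle|move/finj].
have : range f z.
  rewrite fr; split; first by apply: wo_trans fcb => //; apply: on_wo.
  by move=> e; subst z; apply: nfcb; apply: wo_anti fcb zfc; apply: on_wo.
move=> [y _ e]; subst z.
have : range g y by rewrite gr; split; [apply/fle|move=> e; apply: nzfc; rewrite e].
by case=> x _ <-; exists x.
Qed.

End Ordinals.

(** * Ray classes as cosets, and the descent *)

Section Classes.
Set Implicit Arguments.
Unset Strict Implicit.
Unset Printing Implicit Defensive.
Import GRing.Theory.
Local Open Scope ring_scope.
Local Open Scope classical_set_scope.
Variable K : fieldExtType rat.
Local Notation O := (@integers K).
Local Notation fideal := (fractional K).
Implicit Types (m A B b : fideal) (X : set (set K)).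

Lemma P_groupP m (I : set K) : P_group m I <-> exists2 A, ray m A & I = A.
Proof.
split=> [[a [a0 ca ->]]|[_ [a [a0 [ca ->]]] ->]]; last by exists a.
by exists (prin a0) => //; exists a, a0.
Qed.

Lemma P_cosetP m A (I : set K) : P_coset m A I <-> exists2 B, ray m (B - A) & I = B.
Proof.
split=> [[_ /P_groupP [B rB ->] <-]|[B rB ->]].
  by exists (A + B) => //; rewrite addrC addKr.
exists (B - A : fideal); first by apply/P_groupP; exists (B - A).
by rewrite -fidealD addrC subrK.
Qed.

Lemma P_coset_0 m : P_group m = P_coset m (0 : fideal).
Proof.
apply/seteqP; split=> I.
  by move/P_groupP => [A rA ->]; apply/P_cosetP; exists A; rewrite ?subr0.
by move/P_cosetP => [A]; rewrite subr0 => rA ->; apply/P_groupP; exists A.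
Qed.

Section Modulus.
Variable m : fideal.
Hypothesis sm : m `<=` O.

Lemma P_coset_eq A B : ray m (B - A) -> P_coset m A = P_coset m B.
Proof.
move=> rBA; apply/seteqP; split=> I /P_cosetP [C rC ->]; apply/P_cosetP; exists C => //.
  have -> : C - B = (C - A) - (B - A) by rewrite opprB addrA subrK.
  by apply: rayD => //; apply: rayN.
have -> : C - A = (C - B) + (B - A) by rewrite addrA subrK.
exact: rayD.
Qed.

Lemma P_coset_refl A : P_coset m A A.
Proof. by apply/P_cosetP; exists A => //; rewrite subrr; apply: ray0. Qed.

Lemma class_mulE A B : class_mul (P_coset m A) (P_coset m B) = P_coset m (A + B : fideal).
Proof.
apply/seteqP; split=> I.
  move=> [_ /P_cosetP [C rC ->] [_ /P_cosetP [D rD ->] <-]].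
  by apply/P_cosetP; exists (C + D) => //; rewrite opprD addrACA; apply: rayD.
move/P_cosetP => [C rC ->]; exists (A : set K); first exact: P_coset_refl.
exists (C - A : fideal); last by rewrite -fidealD addrC subrK.
by apply/P_cosetP; exists (C - A) => //; rewrite -addrA -opprD.
Qed.

Lemma class_invE A : class_inv (P_coset m A) = P_coset m (- A : fideal).
Proof.
apply/seteqP; split=> I.
  move=> [_ /P_cosetP [C rC ->] <-]; apply/P_cosetP; exists (- C) => //.
  by rewrite -opprD; apply: rayN.
move/P_cosetP => [C rC ->]; exists (- C : fideal); last by rewrite -fidealN opprK.
by apply/P_cosetP; exists (- C) => //; rewrite -opprD; apply: rayN; rewrite // opprK in rC *.
Qed.

Lemma ClP X : Cl m X <-> exists2 A : fideal, prime_to m A & X = P_coset m A.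
Proof.
split=> [[I [/fidealE [A ->] mA] <-]|[A mA ->]]; first by exists A.
exists (A : set K) => //; split; last exact: mA.
exact: fidealP.
Qed.

Lemma Cl_is_subgroup : Cl_subgroup m (Cl m).
Proof.
split=> //.
- apply/ClP; exists 0; last exact: P_coset_0.
  exact/ray_prime_to/ray0.
- move=> _ _ /ClP [A mA ->] /ClP [B mB ->]; apply/ClP; exists (A + B).
    exact: prime_toD.
  exact: class_mulE.
- move=> _ /ClP [A mA ->]; apply/ClP; exists (- A); first exact: prime_toN.
  exact: class_invE.
Qed.

(** Each representative is chosen coprime to the product of [b] and all earlier ones, hence to each
    factor. *)
Lemma pairwise_coprime_reps (R : nat -> fideal) b : b `<=` O ->
  (forall k, prime_to m (R k)) ->
  exists c : nat -> fideal, [/\ forall k, c k `<=` O,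
    forall k, ray m (c k - R k),
    forall k, coprime_ideals b (c k) &
    forall j k, (j < k)%N -> coprime_ideals (c j) (c k)].
Proof.
move=> sb mR.
(* Choosing for all pairs of an index and an ideal at once permits the recursion below; the value 0
   at a non-integral [S] is a dummy. *)
have /choice [e He] : forall kS : nat * fideal, exists E : fideal, kS.2 `<=` O ->
    [/\ E `<=` O, coprime_ideals E kS.2 & ray m (E - R kS.1)].
  move=> [k S] /=; have [sS|nS] := pselect (S `<=` O); last by exists 0.
  by have [E HE] := integral_coprime_rep sm sS (mR k); exists E.
(* [S k] is the product of [b] and the first [k] representatives *)
pose S := fix S k := if k is k'.+1 then S k' + e (k', S k') else b.
have sS k : S k `<=` O.
  by elim: k => //= k IHk; apply: integral_addf => //; have [] := He (k, S k) IHk.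
pose c k := e (k, S k).
have SE k : S k.+1 = S k + c k by [].
have Hc k := He (k, S k) (sS k).
have Sb k : S k `<=` b.
  elim: k => //= k; apply: subset_trans; apply: integral_subD.
  by have [] := Hc k.
have Sc j k : (j < k)%N -> S k `<=` c j.
  elim: k => // k IHk; rewrite ltnS leq_eqVlt SE => /predU1P [->|/IHk].
    by rewrite addrC; apply: integral_subD.
  by apply: subset_trans; apply: integral_subD; have [] := Hc k.
have sc k : c k `<=` O by have [] := Hc k.
exists c; split=> // k; [by have [] := Hc k| |].
  by have [_ ck _] := Hc k; apply: coprimeC; apply: coprimeS (sc k) (Sb k) sb ck.
move=> l kl; have [sl cl _] := Hc l.
by apply: coprimeC; apply: coprimeS sl (Sc _ _ kl) (sc k) cl.
Qed.

Lemma big_classE r (c : 'I_r -> fideal) :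
  \big[@class_mul K/P_group m]_(i < r) P_coset m (c i) = P_coset m (\sum_(i < r) c i).
Proof.
elim/big_rec2: _ => [|i A X _ ->]; [exact: P_coset_0|exact: class_mulE].
Qed.

End Modulus.

Lemma rayS m (n : fideal) A : m `<=` O -> n `<=` m -> ray n A -> ray m A.
Proof.
move=> sm nm [a [a0 [ca ->]]]; exists a, a0; split=> //.
have sn := subset_trans nm sm; apply/(cong1P _ sm).
have /(cong1P _ sn) [x [y [mx my y0 e]]] := ca.
by exists x, y; split=> //; apply: nm.
Qed.

(** Congruence modulo [d m] implies congruence modulo [m], so dividing by [d] gives an ideal in the
    class of [A = a / d]. Its product with [B] is integral because [d] divides [B]. *)
Lemma S_setP m A B (x : set K) : m `<=` O -> S_set m A x -> A + B `<=` O -> B `<=` O ->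
  exists C : fideal, [/\ x = C, ray m (C - A) & C + B `<=` O].
Proof.
move=> sm [a [d [[+ sA'] [+ sD] + + [y [+ [_ sY]] ->]]]] AB sB.
move=> /fidealE [A' eA]; subst a; move=> /fidealE [D eD]; subst d.
move=> cAD; rewrite /ideal_div -fidealN -fidealD => /fideal_inj eA; subst A.
rewrite -fidealD => /P_cosetP [Y rY eY]; subst y.
exists (Y - D); split; first by rewrite -fidealD addrC.
  rewrite opprB addrA subrK; apply: rayS rY => //.
  by rewrite addrC; apply: integral_subD.
have A'BD : A' + B `<=` D by rewrite -(fideal_subD2r (- D)) addrAC subrr.
(* [D] divides [A' B] and is coprime to [A']: with [u] in [A'] congruent to 1 modulo [D], each [z]
   in [B] is a difference of two elements of [D]. *)
have BD : B `<=` D.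
  move=> z Bz; have [u Au Du] := coprime_mem cAD.
  have -> : z = u * z - z * (u - 1) by ring.
  apply: submoduleB; first exact: fideal_submodule.
    by apply: A'BD; apply: mem_ideal_mul.
  by have [_ _ DM] := fideal_submodule D; apply: DM => //; apply: sB.
rewrite -addrA; apply: integral_addf => //.
have : - D + B `<=` - D + D by apply: fideal_subD.
by rewrite addNr.
Qed.

Lemma euclidean_class_generated m r (C : 'I_r -> set (set K)) (phi : set K -> ON)
    (H : set (set (set K))) :
  m `<=` O -> (forall i, Cl m (C i)) -> euclidean_function m C phi ->
  Cl_subgroup m H -> range C `<=` H ->
  forall b, b `<=` O -> prime_to m b -> H (P_coset m b).
Proof.
move=> sm ClC phiC [HCl H1 HM HV] HC b sb mb.
have HD A B : H (P_coset m A) -> H (P_coset m B) -> H (P_coset m (A + B : fideal)).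
  by rewrite -(class_mulE sm); apply: HM.
move eo : (phi b) => o; elim/(well_founded_ind on_lt_wf): o b eo sb mb => o IHo b eo sb mb.
subst o.
have [b1|nb1] := pselect (b = O :> set K).
  by have -> : b = 0; [apply: fideal_inj|rewrite -P_coset_0].
have /choice [R HR] : forall i, exists A, prime_to m A /\ C i = P_coset m A.
  by move=> i; have /ClP [A mA ->] := ClC i; exists A.
(* Beyond [r] the family is continued by the unit ideal, as the coprime representatives are indexed
   by all naturals. *)
pose R' k := if insub k is Some i then R i else 0.
have mR' k : prime_to m (R' k).
  rewrite /R'; case: insub => [i|]; first by case: (HR i).
  exact/(ray_prime_to sm)/ray0.
have [c' [sc' rc' bc' cc']] := pairwise_coprime_reps sm sb mR'.
pose c (i : 'I_r) := c' i.
have CE i : C i = P_coset m (c i).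
  have [_ ->] := HR i; apply: P_coset_eq => //.
  by have := rc' i; rewrite /R' valK.
have mc i : prime_to m (c i).
  rewrite -[c i](subrK (R i)); apply: prime_toD => //; last by case: (HR i).
  by apply: ray_prime_to => //; have := rc' i; rewrite /R' valK.
pose P := \sum_(i < r) c i.
have mP : prime_to m P.
  rewrite /P; elim/big_rec: _ => [|i A _]; first exact/(ray_prime_to sm)/ray0.
  exact: prime_toD.
(* [E] is taken in the class of [b / P], so that [E / b] has the class of [1 / P], as [I_set]
   demands. *)
have [E [sE cEb rE]] := integral_coprime_rep sm sb (prime_toD sm mb (prime_toN sm mP)).
pose t i := E - b + \sum_(j < r | j != i) c j.
have sP i : \sum_(j < r | j != i) c j `<=` O.
  by elim/big_rec: _ => // j A _; apply: integral_addf; apply: sc'.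
have tI : I_set m C b (fun i => t i : set K).
  exists (fun i => c i : set K), (E - b : fideal); split.
  - move=> i; split; last exact/fideal_integral/sc'.
    by rewrite CE; apply: P_coset_refl.
  - split=> [i|i j ij]; first exact: bc'.
    case: (ltngtP i j) => [|ji|/val_inj ij']; first exact: cc'.
      by apply: coprimeC; apply: cc'.
    by rewrite ij' eqxx in ij.
  - under eq_bigr do rewrite CE.
    rewrite big_classE // class_invE //; apply/P_cosetP; exists (E - b) => //.
    by move: rE; rewrite opprD addrA.
  - split; last by rewrite -fidealD subrK; apply/fideal_integral.
    (* If [E / b] were integral, [E] would be inside [b], and coprimality would force [b = O]. *)
    move=> [_ sEb]; apply: nb1; apply/seteqP; split=> //.
    rewrite -[X in X `<=` _]cEb; apply: ideal_add_sub => //.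
      exact: fideal_submodule.
    by rewrite -(subrK b E) addrC; apply: integral_subD.
  - move=> i; rewrite /t fidealD; congr ideal_mul.
    by elim/big_rec2: _ => // j A I _ <-.
have [|i [x Sx ltx]] := phiC b _ nb1 _ tI.
  by split; [split; [apply: fidealP|]|apply/fideal_integral].
have tb : t i + b `<=` O by rewrite /t addrAC subrK; apply: integral_addf.
have [X [eX rX sX]] := S_setP sm Sx tb sb; subst x.
(* The omitted factor [c i] completes the product [P], so [t i] times [c i] is [E P / b], a ray. *)
have rti : ray m (t i + c i).
  have -> : t i + c i = E - (b - P).
    rewrite /t -addrA [\sum_(j < r | _) _ + _]addrC -(bigD1 (P := xpredT) i) //=.
    by rewrite opprB addrA addrAC.
  exact: rE.
have HX : H (P_coset m (X + b : fideal)).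
  apply: (IHo _ ltx) => //; apply: prime_toD => //.
  have -> : X = (X - t i) + ((t i + c i) - c i) by rewrite addrK subrK.
  apply: prime_toD => //; first exact: ray_prime_to.
  by apply: prime_toD => //; [exact: ray_prime_to|apply: prime_toN].
(* [X] has the class of [t i], inverse to that of [c i], so [b] and [X b c_i] have the same
   class. *)
rewrite (P_coset_eq sm (B := X + b + c i)).
  by apply: HD => //; rewrite -CE; apply: HC; exists i.
have -> : X + b + c i - b = (X - t i) + (t i + c i).
  by rewrite addrA subrK [LHS]addrAC addrK.
exact: rayD.
Qed.

End Classes.

Theorem theorem1p1 (K : fieldExtType rat) (m : set K) (r : nat)
    (C : 'I_r -> set (set K)) :
  integral_ideal m ->
  (forall i, Cl m (C i)) ->
  injective C ->
  euclidean_system m C ->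
  Cl_generated m (range C) = Cl m.
Proof.
move=> [fm sm] ClC _ [phi phiC].
have [M eM] := fidealE fm; subst m.
apply/seteqP; split=> X.
  by apply; [exact: Cl_is_subgroup|move=> _ [i _ <-]].
move=> /ClP [A mA ->] H HH HC.
(* Here [0] is the unit ideal, so this asks only for an integral representative of the class. *)
have [E [sE _ rE]] := integral_coprime_rep sm (@subset_refl _ (0 : fractional K)%R) mA.
rewrite (P_coset_eq sm rE); apply: (euclidean_class_generated sm ClC phiC HH HC) => //.
rewrite -[E](GRing.subrK A); apply: prime_toD => //.
exact: ray_prime_to.
Qed.
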